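(* Let $R$ be a Henselian valuation ring with fraction field $K$ and value group $\Gamma$, and assume that $\widehat{K}$ is a separable extension of $K$. Let $X$ be an $R$-scheme of finite presentation. Then: (i) $X(R)$ is dense in $X(\widehat{R})$ for the valuation topology. (ii) If $V$ is a $K$-scheme locally of finite type, then $V(K)$ is dense in $V(\widehat{K})$ for the valuation topology.
   Context: $R$ is a valuation ring with arbitrary value group $\Gamma$ (a totally ordered abelian group, written additively) and fraction field $K$. $\widehat{R}$ is the completion of $R$ for the valuation topology; it is a valuation ring with value group $\Gamma$, and $\widehat{K}$ is its fraction field. Separable field extensions are not assumed algebraic: $\widehat K/K$ separable means that $\widehat K$ is a geometrically reduced $K$-algebra. Topologies: for a Hausdorff topological field $F$ and $F$-schemes $V$ locally of finite type, $V(F)$ carries the unique functorial topology which is the given one on $\mathbb{A}^1(F)=F$, is compatible with products, makes every $F$-morphism induce a continuous map, and makes open (resp. closed) immersions induce open (resp. closed) topological embeddings. For $V$ over $K$, $V(\widehat K)$ is topologized in this way via $V\times_K\widehat K$, with $\widehat K$ carrying its valuation topology. For $X$ of finite presentation over $R$, $X(\widehat R)$ is topologized similarly: for an affine open $U\subset X$, $U(\widehat R)$ has the subspace topology from a closed immersion $U\hookrightarrow\mathbb{A}^n_R$ when one exists (with $\mathbb{A}^n(\widehat R)=\widehat R^{\,n}$), and $X(\widehat R)$ is the union of the open subsets $U(\widehat R)$ (since $\widehat R$ is local). ''Dense'' means that the image of $X(R)$ in $X(\widehat R)$ (resp. of $V(K)$ in $V(\widehat K)$) is dense. *)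

(* Defs.v *)
From HB Require Import structures.
(* The notations of mpoly are incompatible with those of topology. *)
From mathcomp Require Import -(notations) mpoly.
From mathcomp Require Import all_boot all_order all_algebra ring.
From mathcomp Require Import boolp classical_sets filter.
From mathcomp Require Import topology.

Set Implicit Arguments.
Unset Strict Implicit.
Unset Printing Implicit Defensive.

Import Order.TTheory GRing.Theory Num.Theory.

Local Open Scope classical_set_scope.
Local Open Scope ring_scope.
Local Open Scope quotient_scope.

Record spec (A : comNzRingType) := Prime {
  prime_pred : A -> bool;
  prime_ideal : idealr_closed prime_pred;
  prime_prime : prime_idealr_closed prime_pred }.

Coercion prime_mem (A : comNzRingType) (p : spec A) : {pred A} := prime_pred p.

Section PrimeTheory.
Variables (A : comNzRingType) (p : spec A).
Implicit Types a b : A.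

Lemma prime_in0 : 0 \in p.
Proof. by have [] := prime_ideal p. Qed.

Lemma prime_notin1 : 1 \notin p.
Proof. by have [] := prime_ideal p. Qed.

Lemma prime_inMr a b : b \in p -> a * b \in p.
Proof.
by have [p0 _ h] := prime_ideal p; move=> bp; rewrite -[a * b]addr0; exact: h.
Qed.

Lemma prime_inD a b : a \in p -> b \in p -> a + b \in p.
Proof.
by have [_ _ h] := prime_ideal p; move=> ap bp; rewrite -[a]mul1r; exact: h.
Qed.

Lemma prime_notinM a b : a \notin p -> b \notin p -> a * b \notin p.
Proof.
by move=> ap bp; apply/negP => /prime_prime; rewrite (negbTE ap) (negbTE bp).
Qed.

Lemma prime_notinMr a b : a * b \notin p -> b \notin p.
Proof. by apply: contra; exact: prime_inMr. Qed.

Lemma prime_notinMl a b : a * b \notin p -> a \notin p.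
Proof. by rewrite mulrC; exact: prime_notinMr. Qed.

End PrimeTheory.

Lemma prime_ext (A : comNzRingType) (p q : spec A) :
  (forall a, (a \in p) = (a \in q)) -> p = q.
Proof.
case: p q => [p pi pp] [q qi qp] e.
have {}e : p = q by apply: funext => a; exact: e.
by subst q; congr Prime; exact: Prop_irrelevance.
Qed.

Section Localization.
Variables (A : comNzRingType) (p : spec A).
Implicit Types a b c d u : A.

Definition prefrac := {x : A * A | x.2 \notin p}.

Definition prefrac_equiv (x y : prefrac) : bool :=
  `[< exists2 u, u \notin p &
      u * ((val x).1 * (val y).2 - (val y).1 * (val x).2) = 0 >].

Lemma prefrac_equiv_refl : reflexive prefrac_equiv.
Proof.
by move=> x; apply/asboolP; exists 1; [exact: prime_notin1 | rewrite subrr mulr0].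
Qed.

Lemma prefrac_equiv_sym : symmetric prefrac_equiv.
Proof.
by move=> x y; apply/idP/idP => /asboolP[u up e]; apply/asboolP; exists u => //;
  rewrite -opprB mulrN e oppr0.
Qed.

Lemma prefrac_equiv_trans : transitive prefrac_equiv.
Proof.
move=> [[c d] /= dp] [[a b] /= bp] [[e f] /= fp].
move=> /asboolP[/= u up e1] /asboolP[/= w wp e2].
apply/asboolP; exists (u * w * d) => /=; first by rewrite !prime_notinM.
have -> : u * w * d * (a * f - e * b) =
  w * f * (u * (a * d - c * b)) + u * b * (w * (c * f - e * d)) by ring.
by rewrite e1 e2 !mulr0 addr0.
Qed.

Canonical prefrac_equiv_equiv := EquivRel prefrac_equiv
  prefrac_equiv_refl prefrac_equiv_sym prefrac_equiv_trans.

Definition localization := {eq_quot prefrac_equiv}.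

HB.instance Definition _ := EqQuotient.on localization.
HB.instance Definition _ := Choice.on localization.

(* The fraction a / b, with the junk value 0 / 1 when b lies in p. *)
Definition locfrac a b : localization :=
  \pi_localization (insubd (exist _ (0, 1) (prime_notin1 p) : prefrac) (a, b)).

Lemma locfrac_eq a b c d : b \notin p -> d \notin p ->
  locfrac a b = locfrac c d <->
  exists2 u, u \notin p & u * (a * d - c * b) = 0.
Proof.
move=> bp dp; rewrite /locfrac; split.
  move=> /eqP; rewrite piE => /asboolP[u up].
  by rewrite !val_insubd /= bp dp => e; exists u.
move=> [u up e]; apply/eqP; rewrite piE; apply/asboolP; exists u => //.
by rewrite !val_insubd /= bp dp.
Qed.

Lemma locfracP (x : localization) :
  {ab : A * A | ab.2 \notin p & x = locfrac ab.1 ab.2}.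
Proof.
exists (val (repr x)); first exact: (valP (repr x)).
by rewrite /locfrac -surjective_pairing valKd reprK.
Qed.

Definition locnum (x : localization) : A := (s2val (locfracP x)).1.
Definition locden (x : localization) : A := (s2val (locfracP x)).2.

Lemma locden_notin x : locden x \notin p.
Proof. by rewrite /locden; case: (locfracP x). Qed.

Lemma locfracK x : locfrac (locnum x) (locden x) = x.
Proof. by rewrite /locnum /locden; case: (locfracP x). Qed.

Definition locadd x y := locfrac
  (locnum x * locden y + locnum y * locden x) (locden x * locden y).
Definition locopp x := locfrac (- locnum x) (locden x).
Definition locmul x y := locfrac (locnum x * locnum y) (locden x * locden y).

Lemma locaddE a b c d : b \notin p -> d \notin p ->
  locadd (locfrac a b) (locfrac c d) = locfrac (a * d + c * b) (b * d).
Proof.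
move=> bp dp; rewrite /locadd.
set x := locfrac a b; set y := locfrac c d.
have [u up e1] := (locfrac_eq (locnum x) a (locden_notin x) bp).1 (locfracK x).
have [w wp e2] := (locfrac_eq (locnum y) c (locden_notin y) dp).1 (locfracK y).
apply/locfrac_eq; rewrite ?prime_notinM ?locden_notin //.
exists (u * w); first exact: prime_notinM.
transitivity (w * d * locden y * (u * (locnum x * b - a * locden x)) +
   u * b * locden x * (w * (locnum y * d - c * locden y))); first by ring.
by rewrite e1 e2 !mulr0 addr0.
Qed.

Lemma locmulE a b c d : b \notin p -> d \notin p ->
  locmul (locfrac a b) (locfrac c d) = locfrac (a * c) (b * d).
Proof.
move=> bp dp; rewrite /locmul.
set x := locfrac a b; set y := locfrac c d.
have [u up e1] := (locfrac_eq (locnum x) a (locden_notin x) bp).1 (locfracK x).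
have [w wp e2] := (locfrac_eq (locnum y) c (locden_notin y) dp).1 (locfracK y).
apply/locfrac_eq; rewrite ?prime_notinM ?locden_notin //.
exists (u * w); first exact: prime_notinM.
transitivity (w * d * locnum y * (u * (locnum x * b - a * locden x)) +
   u * a * locden x * (w * (locnum y * d - c * locden y))); first by ring.
by rewrite e1 e2 !mulr0 addr0.
Qed.

Lemma locoppE a b : b \notin p -> locopp (locfrac a b) = locfrac (- a) b.
Proof.
move=> bp; rewrite /locopp; set x := locfrac a b.
have [u up e1] := (locfrac_eq (locnum x) a (locden_notin x) bp).1 (locfracK x).
apply/locfrac_eq; rewrite ?locden_notin //.
by exists u => //; rewrite !mulNr -opprD mulrN e1 oppr0.
Qed.

Lemma locfrac_eqW a b c d : b \notin p -> d \notin p ->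
  a * d = c * b -> locfrac a b = locfrac c d.
Proof.
move=> bp dp e; apply/locfrac_eq => //; exists 1; first exact: prime_notin1.
by rewrite e subrr mulr0.
Qed.

Let nots := (prime_notinM, prime_notin1).

Lemma locaddA : associative locadd.
Proof.
move=> x y z; case: (locfracP x) (locfracP y) (locfracP z).
move=> -[a b] /= bp -> [[c d] /= dp ->] [[e f] /= fp ->].
by rewrite !locaddE ?nots //; apply: locfrac_eqW; rewrite ?nots //; ring.
Qed.

Lemma locaddC : commutative locadd.
Proof.
move=> x y; case: (locfracP x) (locfracP y) => -[a b] /= bp -> [[c d] /= dp ->].
by rewrite !locaddE ?nots //; apply: locfrac_eqW; rewrite ?nots //; ring.
Qed.

Lemma locadd0 : left_id (locfrac 0 1) locadd.
Proof.
move=> x; case: (locfracP x) => -[a b] /= bp ->.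
by rewrite !locaddE ?nots //; apply: locfrac_eqW; rewrite ?nots //; ring.
Qed.

Lemma locaddN : left_inverse (locfrac 0 1) locopp locadd.
Proof.
move=> x; case: (locfracP x) => -[a b] /= bp ->.
by rewrite locoppE // locaddE ?nots //; apply: locfrac_eqW; rewrite ?nots //; ring.
Qed.

HB.instance Definition _ :=
  GRing.isZmodule.Build localization locaddA locaddC locadd0 locaddN.

Lemma locmulA : associative locmul.
Proof.
move=> x y z; case: (locfracP x) (locfracP y) (locfracP z).
move=> -[a b] /= bp -> [[c d] /= dp ->] [[e f] /= fp ->].
by rewrite !locmulE ?nots //; apply: locfrac_eqW; rewrite ?nots //; ring.
Qed.

Lemma locmulC : commutative locmul.
Proof.
move=> x y; case: (locfracP x) (locfracP y) => -[a b] /= bp -> [[c d] /= dp ->].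
by rewrite !locmulE ?nots //; apply: locfrac_eqW; rewrite ?nots //; ring.
Qed.

Lemma locmul1 : left_id (locfrac 1 1) locmul.
Proof.
move=> x; case: (locfracP x) => -[a b] /= bp ->.
by rewrite !locmulE ?nots //; apply: locfrac_eqW; rewrite ?nots //; ring.
Qed.

Lemma locmulDl : left_distributive locmul +%R.
Proof.
move=> x y z; rewrite /GRing.add /=; case: (locfracP x) (locfracP y) (locfracP z).
move=> -[a b] /= bp -> [[c d] /= dp ->] [[e f] /= fp ->].
rewrite !(locaddE, locmulE) ?nots //.
by apply: locfrac_eqW; rewrite ?nots //; ring.
Qed.

Lemma locone_neq0 : locfrac 1 1 != 0.
Proof.
apply/eqP => /(locfrac_eq 1 0 (prime_notin1 p) (prime_notin1 p))[u up].
by rewrite mul0r subr0 !mulr1 => u0; rewrite u0 prime_in0 in up.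
Qed.

HB.instance Definition _ := GRing.Zmodule_isComNzRing.Build localization
  locmulA locmulC locmul1 locmulDl locone_neq0.

Lemma locfracD a b c d : b \notin p -> d \notin p ->
  locfrac a b + locfrac c d = locfrac (a * d + c * b) (b * d).
Proof. exact: locaddE. Qed.

Lemma locfracM a b c d : b \notin p -> d \notin p ->
  locfrac a b * locfrac c d = locfrac (a * c) (b * d).
Proof. exact: locmulE. Qed.

Lemma locfracN a b : b \notin p -> - locfrac a b = locfrac (- a) b.
Proof. exact: locoppE. Qed.

Lemma locfrac0 : locfrac 0 1 = 0. Proof. by []. Qed.
Lemma locfrac1 : locfrac 1 1 = 1. Proof. by []. Qed.

End Localization.

Arguments locfrac {A} p a b.

HB.instance Definition _ (A : comNzRingType) := gen_eqMixin (spec A).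
HB.instance Definition _ (A : comNzRingType) := gen_choiceMixin (spec A).

Section Zariski.
Variable A : comNzRingType.

Definition zariski_open : set (set (spec A)) :=
  [set U | exists S : set A,
    U = [set p : spec A | exists2 s, S s & s \notin p]].

Lemma zariski_openT : zariski_open setT.
Proof.
exists setT; apply/seteqP; split=> p _ //=.
by exists 1 => //; exact: prime_notin1.
Qed.

Lemma zariski_openI : setI_closed zariski_open.
Proof.
move=> _ _ [S ->] [T ->].
exists [set a | exists s t, [/\ S s, T t & a = s * t]].
apply/seteqP; split=> p /=.
  move=> [[s Ss sp] [t Tt tp]]; exists (s * t); last exact: prime_notinM.
  by exists s, t.
move=> [_ [s [t [Ss Tt ->]]] stp]; split; [exists s | exists t] => //.
  exact: prime_notinMl stp.
exact: prime_notinMr stp.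
Qed.

Lemma zariski_open_bigU (I : Type) (f : I -> set (spec A)) :
  (forall i, zariski_open (f i)) -> zariski_open (\bigcup_i f i).
Proof.
move=> fo.
exists [set s | exists2 i, [set p : spec A | s \notin p] `<=` f i & True].
apply/seteqP; split=> p /=.
  move=> [i _]; have [S fE] := fo i; rewrite {1}fE => -[s Ss sp].
  by exists s => //; exists i => // q /= sq; rewrite fE; exists s.
by move=> [s [i + _] sp] => /(_ p sp) ?; exists i.
Qed.

HB.instance Definition _ := isOpenTopological.Build (spec A)
  zariski_openT zariski_openI zariski_open_bigU.

Lemma zariski_openE (U : set (spec A)) :
  open U <-> exists S : set A,
    U = [set p : spec A | exists2 s, S s & s \notin p].
Proof. by []. Qed.

Lemma open_notin (b : A) : open [set p : spec A | b \notin p].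
Proof.
apply/zariski_openE; exists [set b]; apply/seteqP; split=> p /=.
  by move=> bp; exists b.
by move=> [_ ->].
Qed.

End Zariski.

Lemma rmorphism_ext (R S : pzSemiRingType) (f g : {rmorphism R -> S}) :
  f =1 g -> f = g.
Proof.
case: f g => [f [[f1] [f2]]] [g [[g1] [g2]]] /= /funext e; subst g.
by rewrite (Prop_irrelevance f1 g1) (Prop_irrelevance f2 g2).
Qed.

Record opens (X : topologicalType) := Opens {
  opens_set :> set X;
  opensP : open opens_set }.

Section Presheaf.
Variables (X : topologicalType) (F : opens X -> comPzRingType).
Variable res : forall U V : opens X, V `<=` U -> {rmorphism F U -> F V}.

(* The germ of s at x is a unit of the stalk of F at x. *)
Definition unit_at (U : opens X) (s : F U) (x : X) : Prop :=
  exists (V : opens X) (VU : V `<=` U),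
    (V : set X) x /\ exists t, t * res VU s = 1.

Definition is_presheaf : Prop :=
  (forall (U : opens X) (h : U `<=` U) s, res h s = s) /\
  (forall (U V W : opens X) (VU : V `<=` U) (WV : W `<=` V) (WU : W `<=` U) s,
    res WV (res VU s) = res WU s).

Definition is_separated_presheaf : Prop :=
  forall (U : opens X) (I : Type) (V : I -> opens X) (VU : forall i, V i `<=` U),
    U `<=` \bigcup_i V i ->
  forall s t : F U, (forall i, res (VU i) s = res (VU i) t) -> s = t.

Definition has_gluing : Prop :=
  forall (U : opens X) (I : Type) (V : I -> opens X) (VU : forall i, V i `<=` U),
    U `<=` \bigcup_i V i ->
  forall s : forall i, F (V i),
    (forall i j (W : opens X) (Wi : W `<=` V i) (Wj : W `<=` V j),
      res Wi (s i) = res Wj (s j)) ->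
  exists t : F U, forall i, res (VU i) t = s i.

(* A ring is local if and only if 0 is not a unit and, for every a, one of a and
   1 - a is a unit; this says so of all the stalks of F. *)
Definition has_local_stalks : Prop :=
  forall (U : opens X) (x : X), (U : set X) x ->
    ~ unit_at (0 : F U) x /\
    forall s : F U, unit_at s x \/ unit_at (1 - s) x.

End Presheaf.

Record locallyRingedSpace := LocallyRingedSpace {
  lrs_top :> topologicalType;
  sec : opens lrs_top -> comPzRingType;
  res : forall U V : opens lrs_top, V `<=` U -> {rmorphism sec U -> sec V};
  lrs_presheaf : is_presheaf res;
  lrs_separated : is_separated_presheaf res;
  lrs_gluing : has_gluing res;
  lrs_local : has_local_stalks res }.

Section Morphism.
Variables X Y : locallyRingedSpace.

Definition opens_preim (f : X -> Y) (fc : forall V, open V -> open (f @^-1` V))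
    (V : opens Y) : opens X :=
  Opens (fc V (opensP V)).

(* mor_local: the induced maps on stalks are local homomorphisms. *)
Record morphism := Morphism {
  mor_fun :> X -> Y;
  mor_cont : forall V, open V -> open (mor_fun @^-1` V);
  mor_sec : forall V : opens Y,
    {rmorphism sec V -> sec (opens_preim mor_cont V)};
  mor_res : forall (V W : opens Y) (WV : W `<=` V)
    (WV' : opens_preim mor_cont W `<=` opens_preim mor_cont V) s,
    mor_sec W (res WV s) = res WV' (mor_sec V s);
  mor_local : forall (V : opens Y) (s : sec V) (x : X), (V : set Y) (mor_fun x) ->
    unit_at (@res X) (mor_sec V s) x -> unit_at (@res Y) s (mor_fun x) }.

(* A homeomorphism onto an open subset that identifies the structure sheaf of X
   with the restriction of that of Y. *)
Definition open_immersion (f : morphism) : Prop :=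
  [/\ injective f,
      forall U : set X, open U -> open (f @` U) &
      forall V : opens Y, V `<=` range f -> bijective (mor_sec f V)].

End Morphism.

Section MorphismTheory.
Variables X Y Z : locallyRingedSpace.

Lemma mor_ext (f g : morphism X Y) : f =1 g ->
  (forall (V : opens Y) s (W : opens X) (h : W `<=` opens_preim (mor_cont f) V)
     (h' : W `<=` opens_preim (mor_cont g) V),
     res h (mor_sec f V s) = res h' (mor_sec g V s)) -> f = g.
Proof.
case: f g => [f fc fs fr fl] [g gc gs gr gl] /= e.
have {}e : f = g by apply: funext.
subst g; have e : fc = gc by exact: Prop_irrelevance.
subst gc => h; have e : fs = gs.
  apply: functional_extensionality_dep => V; apply: rmorphism_ext => s.
  have [resid _] := lrs_presheaf X.
  have := h V s (opens_preim fc V) (@subset_refl _ _) (@subset_refl _ _).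
  by rewrite !resid.
by subst gs; congr Morphism; exact: Prop_irrelevance.
Qed.

Lemma comp_local (g : morphism Y Z) (f : morphism X Y)
    (V : opens Z) (s : sec V) (x : X) : (V : set Z) (g (f x)) ->
  unit_at (@res X) (mor_sec f _ (mor_sec g V s)) x -> unit_at (@res Z) s (g (f x)).
Proof. by move=> Vx /mor_local u; apply: mor_local => //; exact: u. Qed.

Definition comp_mor (g : morphism Y Z) (f : morphism X Y) : morphism X Z.
Proof.
refine (@Morphism X Z (g \o f)
  (fun V oV => mor_cont f (mor_cont g oV))
  (fun V => (mor_sec f (opens_preim (mor_cont g) V) \o mor_sec g V))
  _ (@comp_local g f)).
move=> V W WV WV' s /=.
have h : opens_preim (mor_cont g) W `<=` opens_preim (mor_cont g) V.
  by move=> y; exact: WV.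
by rewrite (mor_res WV h) (mor_res h WV').
Defined.

End MorphismTheory.

Section StructureSheaf.
Variable A : comNzRingType.
Implicit Types U V W : opens (spec A).

(* The sections over U are the families of elements of the local rings A_p, for
   p in U, that are locally given by a single fraction with entries in A. *)
Definition locally_fraction (U : set (spec A))
    (s : forall p, U p -> localization p) : Prop :=
  forall p, U p -> exists V : set (spec A), [/\ open V, V p &
    exists a b : A, forall q (Uq : U q), V q ->
      b \notin q /\ s q Uq = locfrac q a b].

Record spec_sec U := SpecSec {
  spec_val : forall p, (U : set (spec A)) p -> localization p;
  spec_valP : locally_fraction spec_val }.

Lemma spec_sec_ext U (s t : spec_sec U) :
  (forall p (Up : (U : set _) p), spec_val s Up = spec_val t Up) -> s = t.
Proof.
case: s t => [s sP] [t tP] /= e.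
have {}e : s = t.
  apply: functional_extensionality_dep => p.
  by apply: functional_extensionality_dep => Up.
by subst t; congr SpecSec; exact: Prop_irrelevance.
Qed.

HB.instance Definition _ U := gen_eqMixin (spec_sec U).
HB.instance Definition _ U := gen_choiceMixin (spec_sec U).

Section Ring.
Variable U : opens (spec A).
Implicit Types s t : spec_sec U.

Lemma spec_cst_subproof (a : A) :
  locally_fraction (fun p (_ : (U : set _) p) => locfrac p a 1).
Proof.
move=> p Up; exists setT; split => //; first exact: openT.
by exists a, 1 => q _ _; split => //; exact: prime_notin1.
Qed.
Definition spec_cst a := SpecSec (@spec_cst_subproof a).

Lemma spec_add_subproof s t :
  locally_fraction (fun p Up => spec_val s Up + spec_val t Up).
Proof.
move=> p Up; have [V [oV Vp [a [b sE]]]] := spec_valP s Up.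
have [W [oW Wp [c [d tE]]]] := spec_valP t Up.
exists (V `&` W); split => //; first exact: openI.
exists (a * d + c * b), (b * d) => q Uq [Vq Wq].
have [bq ->] := sE q Uq Vq; have [dq ->] := tE q Uq Wq.
by rewrite prime_notinM // locfracD.
Qed.
Definition spec_add s t := SpecSec (spec_add_subproof s t).

Lemma spec_opp_subproof s : locally_fraction (fun p Up => - spec_val s Up).
Proof.
move=> p Up; have [V [oV Vp [a [b sE]]]] := spec_valP s Up.
exists V; split => //; exists (- a), b => q Uq Vq.
by have [bq ->] := sE q Uq Vq; rewrite locfracN.
Qed.
Definition spec_opp s := SpecSec (spec_opp_subproof s).

Lemma spec_mul_subproof s t :
  locally_fraction (fun p Up => spec_val s Up * spec_val t Up).
Proof.
move=> p Up; have [V [oV Vp [a [b sE]]]] := spec_valP s Up.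
have [W [oW Wp [c [d tE]]]] := spec_valP t Up.
exists (V `&` W); split => //; first exact: openI.
exists (a * c), (b * d) => q Uq [Vq Wq].
have [bq ->] := sE q Uq Vq; have [dq ->] := tE q Uq Wq.
by rewrite prime_notinM // locfracM.
Qed.
Definition spec_mul s t := SpecSec (spec_mul_subproof s t).

Lemma spec_addA : associative spec_add.
Proof. by move=> s t r; apply: spec_sec_ext => p Up /=; rewrite addrA. Qed.
Lemma spec_addC : commutative spec_add.
Proof. by move=> s t; apply: spec_sec_ext => p Up /=; rewrite addrC. Qed.
Lemma spec_add0 : left_id (spec_cst 0) spec_add.
Proof. by move=> s; apply: spec_sec_ext => p Up /=; rewrite locfrac0 add0r. Qed.
Lemma spec_addN : left_inverse (spec_cst 0) spec_opp spec_add.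
Proof. by move=> s; apply: spec_sec_ext => p Up /=; rewrite locfrac0 addNr. Qed.
HB.instance Definition _ := GRing.isZmodule.Build (spec_sec U)
  spec_addA spec_addC spec_add0 spec_addN.

Lemma spec_mulA : associative spec_mul.
Proof. by move=> s t r; apply: spec_sec_ext => p Up /=; rewrite mulrA. Qed.
Lemma spec_mulC : commutative spec_mul.
Proof. by move=> s t; apply: spec_sec_ext => p Up /=; rewrite mulrC. Qed.
Lemma spec_mul1 : left_id (spec_cst 1) spec_mul.
Proof. by move=> s; apply: spec_sec_ext => p Up /=; rewrite locfrac1 mul1r. Qed.
Lemma spec_mulDl : left_distributive spec_mul +%R.
Proof. by move=> s t r; apply: spec_sec_ext => p Up /=; rewrite mulrDl. Qed.
HB.instance Definition _ := GRing.Zmodule_isComPzRing.Build (spec_sec U)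
  spec_mulA spec_mulC spec_mul1 spec_mulDl.

End Ring.

Section Restriction.
Variables (U V : opens (spec A)) (VU : V `<=` U).

Lemma spec_res_subproof (s : spec_sec U) :
  locally_fraction (fun p (Vp : (V : set _) p) => spec_val s (VU Vp)).
Proof.
move=> p Vp; have [W [oW Wp [a [b sE]]]] := spec_valP s (VU Vp).
by exists W; split => //; exists a, b => q Vq Wq; exact: sE.
Qed.

Definition spec_res s := SpecSec (@spec_res_subproof s).

Lemma spec_res_zmod : zmod_morphism spec_res.
Proof. by move=> s t; exact: spec_sec_ext. Qed.
Lemma spec_res_monoid : monoid_morphism spec_res.
Proof. by split=> [|s t]; exact: spec_sec_ext. Qed.
HB.instance Definition _ := GRing.isZmodMorphism.Build _ _ spec_res spec_res_zmod.
HB.instance Definition _ := GRing.isMonoidMorphism.Build _ _ spec_res spec_res_monoid.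

End Restriction.

Definition spec_resm U V (VU : V `<=` U) : {rmorphism spec_sec U -> spec_sec V} :=
  spec_res VU.

Lemma spec_presheaf : is_presheaf spec_resm.
Proof.
split=> [U h s|U V W VU WV WU s]; apply: spec_sec_ext => p /= Up;
  by congr (spec_val s); exact: Prop_irrelevance.
Qed.

Lemma spec_separated : is_separated_presheaf spec_resm.
Proof.
move=> U I V VU cov s t e; apply: spec_sec_ext => p Up.
have [i _ Vp] := cov p Up.
have := congr1 (fun r => spec_val r Vp) (e i) => /=.
by rewrite (Prop_irrelevance (VU i p Vp) Up).
Qed.

Lemma spec_gluing : has_gluing spec_resm.
Proof.
move=> U I V VU cov s compat.
pose ix p (Up : (U : set _) p) := cid2 (cov p Up).
pose t p Up := spec_val (s (s2val (ix p Up))) (s2valP' (ix p Up)).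
have tE p Up i (Vp : (V i : set _) p) : t p Up = spec_val (s i) Vp.
  rewrite /t; set j := s2val _; set Vjp := s2valP' _.
  pose W := Opens (openI (opensP (V j)) (opensP (V i))).
  have h := compat j i W (@subIsetl _ _ _) (@subIsetr _ _ _).
  have := congr1 (fun r => spec_val r (conj Vjp Vp : (W : set _) p)) h => /=.
  set L := spec_val (s j) _; set R := spec_val (s i) _ => e.
  rewrite (_ : spec_val (s i) Vp = R); last first.
    by rewrite /R; congr (spec_val (s i)); exact: Prop_irrelevance.
  by rewrite -e /L; congr (spec_val (s j)); exact: Prop_irrelevance.
have tP : locally_fraction t.
  move=> p Up; have [i _ Vp] := cov p Up.
  have [W [oW Wp [a [b sE]]]] := spec_valP (s i) Vp.
  exists (W `&` V i); split => //; first exact: openI oW (opensP _).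
  by exists a, b => q Uq [Wq Vq]; rewrite (tE q Uq i Vq); exact: sE.
by exists (SpecSec tP) => i; apply: spec_sec_ext => p Vp /=; exact: tE.
Qed.

Lemma spec_unit_at U (s : spec_sec U) p (Up : (U : set _) p) a b : b \notin p ->
  spec_val s Up = locfrac p a b -> unit_at spec_resm s p <-> a \notin p.
Proof.
move=> bp sE; split=> [[V [VU [Vp [t tE]]]]|ap].
  have := congr1 (fun r => spec_val r Vp) tE => /=.
  rewrite (Prop_irrelevance (VU p Vp) Up) sE.
  have [[c d] /= dp ->] := locfracP (spec_val t Vp).
  rewrite locfracM // => /(locfrac_eq _ _ (prime_notinM dp bp) (prime_notin1 p)).
  move=> [u up]; rewrite mulr1 mul1r => e.
  have nin : u * (d * b) \notin p by rewrite !prime_notinM.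
  apply: contra nin => ap.
  rewrite (_ : u * (d * b) = u * c * a - u * (c * a - d * b)); last by ring.
  by rewrite e subr0; exact: prime_inMr.
have [W [oW Wp [c [d cE]]]] := spec_valP s Up.
have [dp] := cE p Up Wp; rewrite sE => /(locfrac_eq _ _ bp dp)[u up e].
have cp : c \notin p.
  have nin : u * (a * d) \notin p by rewrite !prime_notinM.
  apply: contra nin => cp.
  rewrite (_ : u * (a * d) = u * b * c + u * (a * d - c * b)); last by ring.
  by rewrite e addr0; exact: prime_inMr.
pose V := Opens (openI (openI oW (opensP U)) (open_notin c)).
have VU : V `<=` U by move=> q [[]].
exists V, VU; split => //.
have tP : locally_fraction (fun q (Vq : (V : set _) q) => locfrac q d c).
  move=> q Vq; exists V; split => //; first exact: opensP.
  by exists d, c => r Vr _; split => //; case: Vr.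
exists (SpecSec tP); apply: spec_sec_ext => q /= Vq.
have [[Wq Uq] /= cq] := Vq.
have [dq ->] := cE q (VU q Vq) Wq; rewrite locfracM //.
by apply: locfrac_eqW; rewrite ?prime_notinM ?prime_notin1 // mulr1 mul1r mulrC.
Qed.

Lemma spec_local : has_local_stalks spec_resm.
Proof.
move=> U p Up; split.
  move=> /(@spec_unit_at U 0 p Up 0 1 (prime_notin1 p) erefl).
  by rewrite prime_in0.
move=> s; have [W [oW Wp [a [b sE]]]] := spec_valP s Up.
have [bp {}sE] := sE p Up Wp.
have [ap|ap] := boolP (a \in p); [right|left].
  apply/(@spec_unit_at U (1 - s) p Up (b - a) b bp).
    rewrite [LHS](_ : _ = 1 - spec_val s Up) // sE -locfrac1 locfracN //.
    rewrite locfracD ?prime_notin1 //.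
    apply: locfrac_eqW; rewrite ?prime_notinM ?prime_notin1 //; ring.
  apply: contra bp => ba; rewrite -(subrK a b); exact: prime_inD.
exact/(spec_unit_at bp sE).
Qed.

Definition Spec : locallyRingedSpace := @LocallyRingedSpace (spec A)
  (fun U => spec_sec U) spec_resm
  spec_presheaf spec_separated spec_gluing spec_local.

End StructureSheaf.

Section SpecMap.
Variables (A B : comNzRingType) (phi : {rmorphism A -> B}).

Section Comap.
Variable q : spec B.

Lemma comap_ideal : idealr_closed (fun a => phi a \in q).
Proof.
split; rewrite ?inE ?unfold_in /= ?rmorph0 ?rmorph1; [exact: prime_in0 | exact: prime_notin1 |].
move=> a u v; rewrite !unfold_in rmorphD rmorphM => uq vq.
by apply: prime_inD => //; exact: prime_inMr.
Qed.

Lemma comap_prime : prime_idealr_closed (fun a => phi a \in q).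
Proof. by move=> a b; rewrite !unfold_in rmorphM; exact: prime_prime. Qed.

Definition comap : spec A := Prime comap_ideal comap_prime.

Lemma in_comap a : (a \in comap) = (phi a \in q). Proof. by []. Qed.

Definition locmap (x : localization comap) : localization q :=
  locfrac q (phi (locnum x)) (phi (locden x)).

Lemma locmapE a b : b \notin comap ->
  locmap (locfrac comap a b) = locfrac q (phi a) (phi b).
Proof.
move=> bp; rewrite /locmap; set x := locfrac _ a b.
have [u up e] := (locfrac_eq (locnum x) a (locden_notin x) bp).1 (locfracK x).
apply/locfrac_eq; rewrite -?in_comap ?locden_notin //.
by exists (phi u) => //; rewrite -!rmorphM -rmorphB -rmorphM e rmorph0.
Qed.

Lemma locmap_zmod : zmod_morphism locmap.
Proof.
move=> x y; have [[a b] /= bp ->] := locfracP x.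
have [[c d] /= dp ->] := locfracP y.
rewrite locfracN // locfracD // !locmapE ?prime_notinM // locfracN -?in_comap //.
by rewrite locfracD -?in_comap // rmorphD !rmorphM rmorphN.
Qed.

Lemma locmap_monoid : monoid_morphism locmap.
Proof.
split=> [|x y].
  by rewrite -locfrac1 locmapE ?prime_notin1 // rmorph1 locfrac1.
have [[a b] /= bp ->] := locfracP x; have [[c d] /= dp ->] := locfracP y.
by rewrite locfracM // !locmapE ?prime_notinM // locfracM -?in_comap // !rmorphM.
Qed.

HB.instance Definition _ := GRing.isZmodMorphism.Build _ _ locmap locmap_zmod.
HB.instance Definition _ := GRing.isMonoidMorphism.Build _ _ locmap locmap_monoid.

End Comap.

Lemma comap_cont (V : set (spec A)) : open V -> open (comap @^-1` V).
Proof.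
move=> /zariski_openE[S ->]; apply/zariski_openE; exists (phi @` S).
apply/seteqP; split=> q /=.
  by move=> [s Ss sq]; exists (phi s) => //; exists s.
by move=> [_ [s Ss <-] sq]; exists s.
Qed.

Section Pullback.
Variable V : opens (Spec A).
Let V' : opens (Spec B) := @opens_preim (Spec B) (Spec A) comap comap_cont V.

Lemma spec_pull_subproof (s : spec_sec V) :
  locally_fraction (fun q (Vq : (V' : set (spec B)) q) => locmap (spec_val s Vq)).
Proof.
move=> q Vq; have [W [oW Wq [a [b sE]]]] := spec_valP s Vq.
exists (comap @^-1` W); split => //; first exact: comap_cont.
exists (phi a), (phi b) => r Vr Wr; have [br ->] := sE _ Vr Wr.
by rewrite locmapE.
Qed.

Definition spec_pull (s : spec_sec V) : spec_sec V' := SpecSec (@spec_pull_subproof s).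

Lemma spec_pull_zmod : zmod_morphism spec_pull.
Proof. by move=> s t; apply: spec_sec_ext => q Vq /=; rewrite -rmorphB. Qed.
Lemma spec_pull_monoid : monoid_morphism spec_pull.
Proof.
split=> [|s t]; apply: spec_sec_ext => q Vq; last exact: (rmorphM (@locmap q)).
exact: (rmorph1 (@locmap q)).
Qed.
HB.instance Definition _ := GRing.isZmodMorphism.Build _ _ spec_pull spec_pull_zmod.
HB.instance Definition _ := GRing.isMonoidMorphism.Build _ _ spec_pull spec_pull_monoid.

End Pullback.

Definition spec_pullm (V : opens (Spec A)) :
  {rmorphism @sec (Spec A) V ->
    @sec (Spec B) (@opens_preim (Spec B) (Spec A) comap comap_cont V)} :=
  @spec_pull V.

Lemma spec_pull_local (V : opens (Spec A)) (s : sec V) (q : Spec B) :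
  (V : set (Spec A)) (comap q) ->
  unit_at (@res (Spec B)) (spec_pullm V s) q -> unit_at (@res (Spec A)) s (comap q).
Proof.
move=> Vq; have [W [oW Wq [a [b sE]]]] := spec_valP s Vq.
have {sE} [bq sE] := sE _ Vq Wq.
have pE : @spec_val B (@opens_preim (Spec B) (Spec A) comap comap_cont V)
    (spec_pullm V s) q Vq = locfrac q (phi a) (phi b).
  by rewrite /= sE locmapE.
move=> /(spec_unit_at (bq : phi b \notin q) pE) aq.
by apply/(spec_unit_at bq sE).
Qed.

Lemma spec_pull_res (V W : opens (Spec A)) (WV : W `<=` V)
    (WV' : @opens_preim (Spec B) (Spec A) comap comap_cont W `<=`
           @opens_preim (Spec B) (Spec A) comap comap_cont V) (s : sec V) :
  spec_pullm W (res WV s) = res WV' (spec_pullm V s).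
Proof.
apply: spec_sec_ext => q Wq /=; congr (locmap (spec_val s _)).
exact: Prop_irrelevance.
Qed.

Definition Spec_map : morphism (Spec B) (Spec A) :=
  @Morphism (Spec B) (Spec A) comap comap_cont spec_pullm
    spec_pull_res spec_pull_local.

End SpecMap.

Lemma Spec_map_comp (A B C : comNzRingType) (f : {rmorphism A -> B})
    (g : {rmorphism B -> C}) (h : {rmorphism A -> C}) : h =1 g \o f ->
  Spec_map h = comp_mor (Spec_map f) (Spec_map g).
Proof.
move=> hE; apply: mor_ext => [q|V s W h1 h2].
  by apply: prime_ext => a; rewrite [LHS]in_comap hE.
apply: spec_sec_ext => q Wq /=.
have [U [oU Uq [a [b sE]]]] := spec_valP s (h1 q Wq).
have e : comap h q = comap f (comap g q).
  by apply: prime_ext => c; rewrite [LHS]in_comap hE.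
have [bq ->] := sE _ (h1 q Wq) Uq.
have Uq' : U (comap f (comap g q)) by rewrite -e.
have [bq' E] := sE _ (h2 q Wq) Uq'.
rewrite locmapE // !hE /=.
rewrite (_ : spec_val s (h2 q Wq) = locfrac _ a b) //.
by rewrite (@locmapE _ _ f (comap g q) a b bq') (@locmapE _ _ g q _ _ bq').
Qed.

Lemma comp_morA (X Y Z T : locallyRingedSpace) (h : morphism Z T)
    (g : morphism Y Z) (f : morphism X Y) :
  comp_mor (comp_mor h g) f = comp_mor h (comp_mor g f).
Proof.
apply: mor_ext => // V s W h1 h2 /=.
by rewrite (Prop_irrelevance h1 h2).
Qed.

Definition is_affine (X : locallyRingedSpace) (U : set X) : Prop :=
  exists (A : comNzRingType) (j : morphism (Spec A) X),
    open_immersion j /\ range j = U.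

(* Only spectra of nonzero rings are used; Spec 0 is empty, so it is never needed
   in a cover. *)
Definition is_scheme (X : locallyRingedSpace) : Prop :=
  forall x : X, exists2 U : set X, is_affine U & U x.

Record schemeOver (A : comNzRingType) := SchemeOver {
  so_space :> locallyRingedSpace;
  so_scheme : is_scheme so_space;
  so_str : morphism so_space (Spec A) }.

Section RingMaps.
Variables (A C : comNzRingType) (psi : {rmorphism A -> C}).

Definition generates n (c : 'I_n -> C) : Prop :=
  forall x : C, exists P : mpoly n A, x = mmap psi c P.

Definition finite_type_map : Prop := exists n (c : 'I_n -> C), generates c.

Definition finite_pres_map : Prop :=
  exists n (c : 'I_n -> C), generates c /\
  exists m (g : 'I_m -> mpoly n A), forall P : mpoly n A,
    mmap psi c P = 0 <->
    exists h : 'I_m -> mpoly n A, P = \sum_i h i * g i.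

End RingMaps.

Section SchemeOver.
Variables (A : comNzRingType) (X : schemeOver A).

(* A nonempty affine open subscheme of X, presented as the spectrum of an
   A-algebra. *)
Record chart := Chart {
  ch_ring : comNzRingType;
  ch_alg : {rmorphism A -> ch_ring};
  ch_imm : morphism (Spec ch_ring) X;
  ch_open : open_immersion ch_imm;
  ch_over : comp_mor (so_str X) ch_imm = Spec_map ch_alg }.

Definition locally_of_finite_type : Prop :=
  forall x : X, exists2 c : chart, range (ch_imm c) x & finite_type_map (ch_alg c).

Definition locally_of_finite_presentation : Prop :=
  forall x : X, exists2 c : chart, range (ch_imm c) x & finite_pres_map (ch_alg c).

Definition quasi_compact : Prop := compact [set: X].

(* Since the base Spec A is affine, this is equivalent to the quasi-compactness of
   the diagonal of X over Spec A. *)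
Definition quasi_separated : Prop := forall U V : set X,
  open U -> open V -> compact U -> compact V -> compact (U `&` V).

Definition of_finite_presentation : Prop :=
  [/\ locally_of_finite_presentation, quasi_compact & quasi_separated].

Record scheme_point (B : comNzRingType) (phi : {rmorphism A -> B}) := Point {
  pt_mor :> morphism (Spec B) X;
  pt_over : comp_mor (so_str X) pt_mor = Spec_map phi }.

Section BaseChange.
Variables (B B' : comNzRingType).
Variables (phi : {rmorphism A -> B}) (phi' : {rmorphism A -> B'}).
Variables (rho : {rmorphism B -> B'}) (phiE : phi' =1 rho \o phi).

Lemma map_point_over (x : scheme_point phi) :
  comp_mor (so_str X) (comp_mor x (Spec_map rho)) = Spec_map phi'.
Proof. by rewrite -comp_morA pt_over (Spec_map_comp phiE). Qed.

Definition map_point (x : scheme_point phi) : scheme_point phi' := Point (map_point_over x).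

End BaseChange.

End SchemeOver.

(* No compatibility is required between the topology and the ring operations. *)
#[short(type="preTopologicalComNzRingType")]
HB.structure Definition PreTopologicalComNzRing :=
  {B of Topological B & GRing.ComNzRing B}.

Section PointTopology.
Variables (A : comNzRingType) (B : preTopologicalComNzRingType).
Variables (X : schemeOver A) (phi : {rmorphism A -> B}).

Definition top_point := scheme_point X phi.

HB.instance Definition _ := gen_eqMixin top_point.
HB.instance Definition _ := gen_choiceMixin top_point.

(* Let U be an affine open subscheme of X, the spectrum of an A-algebra C generated
   by e_1, ..., e_n. The generators define a closed immersion of U into affine
   n-space, and a B-point of U, that is, a morphism of A-algebras theta : C -> B,
   has coordinates theta(e_1), ..., theta(e_n) in B^n. The topology below is the
   finest one for which all inclusions U(B) -> X(B) are continuous, where U(B) has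
   the subspace topology of B^n. *)
Definition point_open : set (set top_point) := [set W |
  forall (c : chart X) n (e : 'I_n -> ch_ring c), generates (ch_alg c) e ->
  exists2 O : set 'rV[B]_n, open O &
    forall (theta : {rmorphism ch_ring c -> B}) (x : top_point),
      pt_mor x = comp_mor (ch_imm c) (Spec_map theta) ->
      W x <-> O (\row_i theta (e i))].

Lemma point_openT : point_open setT.
Proof. by move=> c n e _; exists setT => //; exact: openT. Qed.

Lemma point_openI : setI_closed point_open.
Proof.
move=> W W' Wo Wo' c n e ge; have [O oO WE] := Wo c n e ge.
have [O' oO' WE'] := Wo' c n e ge; exists (O `&` O'); first exact: openI.
by move=> theta x xE; split=> -[/(WE _ _ xE) ? /(WE' _ _ xE) ?].
Qed.

Lemma point_open_bigU (I : Type) (f : I -> set top_point) :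
  (forall i, point_open (f i)) -> point_open (\bigcup_i f i).
Proof.
move=> fo c n e ge; pose O i := s2val (cid2 (fo i c n e ge)).
exists (\bigcup_i O i).
  by apply: bigcup_open => i _; exact: s2valP (cid2 (fo i c n e ge)).
move=> theta x xE.
by split=> -[i _ h]; exists i => //; apply/(s2valP' (cid2 (fo i c n e ge)) _ _ xE).
Qed.

HB.instance Definition _ := isOpenTopological.Build top_point
  point_openT point_openI point_open_bigU.

(* The image of X(A) in X(B); the A-points are the sections of so_str X. *)
Definition base_points : set top_point :=
  range (map_point (phi := idfun) (phi' := phi) (rho := phi) (fun=> erefl)).

End PointTopology.

Arguments base_points {A B} X phi _.

(* Totally ordered abelian groups. *)
Record orderedGroup := OrderedGroup {
  og_zmod :> porderZmodType;
  og_total : total (<=%R : rel og_zmod);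
  og_leD2l : forall x y z : og_zmod, x <= y -> z + x <= z + y }.

(* Only the values at nonzero elements matter; v 0 stands for +oo. G is the whole
   value group. *)
Record valuation (G : orderedGroup) (K : fieldType) := Valuation {
  val_fun :> K -> G;
  valM : forall x y, x != 0 -> y != 0 ->
    val_fun (x * y) = val_fun x + val_fun y;
  valD : forall x y, x != 0 -> y != 0 -> x + y != 0 ->
    Num.min (val_fun x) (val_fun y) <= val_fun (x + y);
  val_surj : forall g, exists2 x, x != 0 & val_fun x = g }.

Section ValuationTheory.
Variables (G : orderedGroup) (K : fieldType) (v : valuation G K).

(* The open ball of radius g around 0. The inequality is strict so that the
   topology is discrete when G is trivial. *)
Definition vball (g : G) : set K := [set x | x = 0 \/ g < v x].

Lemma val_N x : x != 0 -> v (- x) = v x.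
Proof.
have n1 : (- 1 : K) != 0 by rewrite oppr_eq0 oner_neq0.
have v1 : v 1 = 0.
  have := valM v (oner_neq0 K) (oner_neq0 K); rewrite mulr1 => /eqP.
  by rewrite -subr_eq0 opprD addNKr oppr_eq0 => /eqP.
have vn : v (- 1) + v (- 1) = 0 by rewrite -valM // mulrNN mulr1.
have vn0 : v (- 1) = 0.
  have [h|h] := orP (og_total 0 (v (- 1))).
    apply/eqP; rewrite eq_le h andbT.
    by have := og_leD2l (v (- 1)) h; rewrite addr0 vn.
  have := og_leD2l (v (- 1)) h; rewrite addr0 vn => h'.
  by apply/eqP; rewrite eq_le h h'.
by move=> x0; rewrite -mulN1r valM // vn0 add0r.
Qed.

Lemma vballN g x : vball g x -> vball g (- x).
Proof.
have [->|x0] := eqVneq x 0; first by rewrite oppr0; left.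
by case=> [/eqP|h]; [rewrite (negbTE x0) | right; rewrite val_N].
Qed.

Lemma vballD g x y : vball g x -> vball g y -> vball g (x + y).
Proof.
have [->|x0] := eqVneq x 0; first by rewrite add0r.
have [->|y0] := eqVneq y 0; first by rewrite addr0.
have [->|xy0] := eqVneq (x + y) 0; first by left.
case=> [/eqP|gx]; first by rewrite (negbTE x0).
case=> [/eqP|gy]; first by rewrite (negbTE y0).
right; apply: lt_le_trans (valD v x0 y0 xy0).
by rewrite comparable_lt_min ?gx ?gy //; exact: og_total.
Qed.

Lemma vball_le g h : h <= g -> vball g `<=` vball h.
Proof. by move=> hg x [->|gx]; [left | right; exact: le_lt_trans gx]. Qed.

End ValuationTheory.

(* The ring B with the uniform structure pulled back along i from that of the
   valuation v: for i the identity this is the valuation topology of K, for i the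
   inclusion of the valuation ring that of the valuation ring. *)
Definition valued (G : orderedGroup) (K : fieldType) (v : valuation G K)
  (B : comNzRingType) (i : {rmorphism B -> K}) : Type := B.

Section Valued.
Variables (G : orderedGroup) (K : fieldType) (v : valuation G K).
Variables (B : comNzRingType) (i : {rmorphism B -> K}).
Local Notation T := (valued v i).

HB.instance Definition _ := GRing.ComNzRing.copy T B.

Definition val_entourage : set_system (T * T) :=
  [set E | exists g : G, [set xy | vball v g (i xy.1 - i xy.2)] `<=` E].

Lemma val_entourage_filter : Filter val_entourage.
Proof.
split=> [|E F [g gE] [h hF]|E F EF [g gE]]; first by exists 0.
  have [gh|hg] := orP (og_total g h); [exists h | exists g] => xy xyE; split.
  - by apply: gE; exact: vball_le xyE.
  - exact: hF.
  - exact: gE.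
  - by apply: hF; exact: vball_le xyE.
by exists g; exact: subset_trans EF.
Qed.

Lemma val_entourage_diagonal E : val_entourage E -> diagonal `<=` E.
Proof. by move=> [g gE] [x y] xy; apply: gE; left; rewrite /= (xy : x = y) subrr. Qed.

Lemma val_entourage_inv E : val_entourage E -> val_entourage (E^-1)%relation.
Proof.
by move=> [g gE]; exists g => -[x y] /= /vballN; rewrite opprB => xy; exact: gE.
Qed.

Lemma val_entourage_split E : val_entourage E ->
  exists2 F, val_entourage F & (F \; F `<=` E)%relation.
Proof.
move=> [g gE]; exists [set xy | vball v g (i xy.1 - i xy.2)]; first by exists g.
move=> [x z] /= [y xy yz]; apply: gE => /=.
by rewrite -(subrKA (i y)); exact: vballD.
Qed.

HB.instance Definition _ := isUniform.Build T val_entourage_filter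
  val_entourage_diagonal val_entourage_inv val_entourage_split.

End Valued.

Section ValuationRing.
Variable G : orderedGroup.

(* R is the valuation ring of v. *)
Definition is_valuation_ring (R : idomainType) (v : valuation G {fraction R}) :=
  forall x, (exists a : R, x = tofrac a) <-> x = 0 \/ 0 <= v x.

(* For a local ring R, whose maximal ideal is the set of nonunits: a simple root of
   p in the residue field, here represented by a, lifts to a root of p in R. *)
Definition henselian (R : idomainType) : Prop :=
  forall (p : {poly R}) (a : R), p \is monic ->
    p.[a] \isn't a GRing.unit -> p^`().[a] \is a GRing.unit ->
  exists2 b, p.[b] = 0 & b - a \isn't a GRing.unit.

(* Rh, with its map from R, is the completion of R for the valuation topology; it
   is equipped with the extension of v to its fraction field, and j is the induced
   map of fraction fields. *)
Record is_completion (R Rh : idomainType) (v : valuation G {fraction R})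
    (vh : valuation G {fraction Rh}) (phi : {rmorphism R -> Rh})
    (j : {rmorphism {fraction R} -> {fraction Rh}}) : Prop := IsCompletion {
  compl_frac : forall a, j (tofrac a) = tofrac (phi a);
  compl_val : forall x, x != 0 -> vh (j x) = v x;
  compl_dense : dense (range (phi : R -> valued vh (@tofrac Rh)));
  compl_complete : forall F : set_system (valued vh (@tofrac Rh)),
    ProperFilter F -> cauchy F -> exists x : valued vh (@tofrac Rh), F --> x }.

End ValuationRing.

Definition reduced (T : pzSemiRingType) : Prop :=
  forall (x : T) n, x ^+ n = 0 -> x = 0.

(* T, with f and g, is the tensor product of B and C over k, characterized as the
   coproduct of commutative k-algebras. *)
Definition is_tensor_product (k B C T : comPzRingType)
    (b : {rmorphism k -> B}) (c : {rmorphism k -> C})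
    (f : {rmorphism B -> T}) (g : {rmorphism C -> T}) : Prop :=
  f \o b =1 g \o c /\
  forall (S : comPzRingType) (f' : {rmorphism B -> S}) (g' : {rmorphism C -> S}),
    f' \o b =1 g' \o c ->
    exists! h : {rmorphism T -> S}, h \o f =1 f' /\ h \o g =1 g'.

Definition geometrically_reduced (k : fieldType) (B : comPzRingType)
    (b : {rmorphism k -> B}) : Prop :=
  forall (L : fieldType) (l : {rmorphism k -> L}) (T : comPzRingType)
    (f : {rmorphism B -> T}) (g : {rmorphism L -> T}),
  is_tensor_product b l f g -> reduced T.

(* Main.v *)
(* A point of a scheme over the local ring Rhat, or over Khat, lies in an affine
   chart Spec C; choosing generators of C makes it a point x of affine n-space. It is
   then enough to find points y of K^n arbitrarily close to x at which every
   polynomial over K vanishing at x vanishes, for R-points come for free: a point of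
   K^n close to a point of Rhat^n lies in R^n.

   If x satisfies no polynomial relation over K, approximate its coordinates
   arbitrarily. Otherwise take a relation F of least total degree. Mac Lane's
   criterion, a consequence of geometric reducedness, forbids F to be a polynomial in
   p-th powers, so some coordinate x_i is separable algebraic over the field generated
   by the others. By induction on n the other coordinates can be specialized to K, and
   then the minimal polynomial of x_i specializes to a polynomial with an approximate
   simple root near x_i, which Newton's method, available because R is Henselian,
   corrects to a root. *)
From HB Require Import structures.
Require Import Defs.
From mathcomp Require Import -(notations) mpoly.
From mathcomp Require Import all_boot all_order all_algebra ring.
From mathcomp Require Import boolp classical_sets filter topology.

Set Implicit Arguments.
Unset Strict Implicit.
Unset Printing Implicit Defensive.

Import Order.TTheory GRing.Theory.
Local Open Scope classical_set_scope.
Local Open Scope ring_scope.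
Local Open Scope quotient_scope.

(** * Tensor products *)

Section TensorProduct.
Variables (k B C : comPzRingType) (b : {rmorphism k -> B}) (c : {rmorphism k -> C}).
Implicit Types (s t : seq (B * C)) (l : B -> k).

Definition linear_form l : Prop :=
  (forall x y, l (x + y) = l x + l y) /\ (forall a x, l (b a * x) = a * l x).

(** The map [l] tensored with the identity of [C], followed by the identification of k tensor C with
    C. *)
Definition tens_form l s : C := \sum_(x <- s) c (l x.1) * x.2.

Definition tens_eval (S : comPzRingType) (f : B -> S) (g : C -> S) s : S :=
  \sum_(x <- s) f x.1 * g x.2.

(* The tensor product is the ring of formal sums of b (x) c modulo tens_equiv. That
   all evaluations agree gives the universal property at once; that all linear forms
   agree makes it possible to detect nonzero elements. *)
Definition tens_equiv s t : bool :=
  `[< (forall l, linear_form l -> tens_form l s = tens_form l t) /\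
      (forall (S : comPzRingType) (f : {rmorphism B -> S}) (g : {rmorphism C -> S}),
        f \o b =1 g \o c -> tens_eval f g s = tens_eval f g t) >].

Lemma tens_equiv_refl : reflexive tens_equiv.
Proof. by move=> s; apply/asboolP. Qed.

Lemma tens_equiv_sym : symmetric tens_equiv.
Proof.
by move=> s t; apply/asboolP/asboolP => -[h1 h2]; split=> *;
  rewrite ?h1 ?h2.
Qed.

Lemma tens_equiv_trans : transitive tens_equiv.
Proof.
move=> t s r /asboolP[h1 h2] /asboolP[h3 h4]; apply/asboolP.
by split=> *; rewrite ?h1 ?h2 ?h3 ?h4.
Qed.

Canonical tens_equivRel :=
  EquivRel tens_equiv tens_equiv_refl tens_equiv_sym tens_equiv_trans.

Definition tens := {eq_quot tens_equiv}.

HB.instance Definition _ := EqQuotient.on tens.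
HB.instance Definition _ := Choice.on tens.

Definition mktens s : tens := \pi_tens s.

Lemma mktensP s t : mktens s = mktens t <-> tens_equiv s t.
Proof. by rewrite /mktens; split=> [/eqP|h]; [|apply/eqP]; rewrite piE. Qed.

Lemma mktensK (x : tens) : mktens (repr x) = x.
Proof. exact: reprK. Qed.

Lemma tens_form_cat l s t : tens_form l (s ++ t) = tens_form l s + tens_form l t.
Proof. exact: big_cat. Qed.

Definition opp_seq s := [seq (- x.1, x.2) | x <- s].
Definition mul_seq s t := [seq (x.1 * y.1, x.2 * y.2) | x <- s, y <- t].

Lemma linear_formN l x : linear_form l -> l (- x) = - l x.
Proof.
by move=> [_ h]; have := h (-1) x; rewrite rmorphN rmorph1 !mulN1r.
Qed.

Lemma linear_formM l y : linear_form l -> linear_form (fun x => l (x * y)).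
Proof.
by move=> [h1 h2]; split=> *; rewrite ?mulrDl ?h1 -?mulrA ?h2.
Qed.

Lemma tens_form_opp l s : linear_form l -> tens_form l (opp_seq s) = - tens_form l s.
Proof.
move=> lf; rewrite /tens_form big_map -sumrN; apply: eq_bigr => x _ /=.
by rewrite linear_formN // rmorphN mulNr.
Qed.

(** Each first entry of [t] is absorbed into the form by [linear_formM]. Only forms on [s] remain,
    so equivalence of left factors is preserved. *)
Lemma tens_form_mul l s t : linear_form l -> tens_form l (mul_seq s t) =
  \sum_(y <- t) tens_form (fun x => l (x * y.1)) s * y.2.
Proof.
move=> lf; rewrite /tens_form /mul_seq big_allpairs_dep exchange_big /=; apply: eq_bigr => y _.
by rewrite mulr_suml; apply: eq_bigr => x _ /=; rewrite mulrA.
Qed.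

Section Eval.
Variables (S : comPzRingType) (f : {rmorphism B -> S}) (g : {rmorphism C -> S}).

Lemma tens_eval_cat s t :
  tens_eval f g (s ++ t) = tens_eval f g s + tens_eval f g t.
Proof. exact: big_cat. Qed.

Lemma tens_eval_opp s : tens_eval f g (opp_seq s) = - tens_eval f g s.
Proof.
rewrite /tens_eval big_map -sumrN; apply: eq_bigr => x _ /=.
by rewrite rmorphN mulNr.
Qed.

Lemma tens_eval_mul s t :
  tens_eval f g (mul_seq s t) = tens_eval f g s * tens_eval f g t.
Proof.
rewrite /tens_eval /mul_seq big_allpairs_dep mulr_suml; apply: eq_bigr => x _.
rewrite mulr_sumr; apply: eq_bigr => y _ /=.
by rewrite !rmorphM mulrACA.
Qed.

End Eval.

Let evE := (tens_form_cat, tens_eval_cat, tens_form_opp, tens_eval_opp,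
  tens_form_mul, tens_eval_mul).

Definition tens_add (x y : tens) := mktens (repr x ++ repr y).
Definition tens_opp (x : tens) := mktens (opp_seq (repr x)).
Definition tens_mul (x y : tens) := mktens (mul_seq (repr x) (repr y)).

Lemma repr_mktens s : tens_equiv (repr (mktens s)) s.
Proof. by apply/mktensP; rewrite mktensK. Qed.

Lemma tens_addE s t : tens_add (mktens s) (mktens t) = mktens (s ++ t).
Proof.
apply/mktensP; have /asboolP[s1 s2] := repr_mktens s.
have /asboolP[t1 t2] := repr_mktens t; apply/asboolP.
by split=> *; rewrite !evE ?s1 ?s2 ?t1 ?t2.
Qed.

Lemma tens_oppE s : tens_opp (mktens s) = mktens (opp_seq s).
Proof.
apply/mktensP; have /asboolP[s1 s2] := repr_mktens s; apply/asboolP.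
by split=> *; rewrite !evE ?s1 ?s2.
Qed.

Lemma mul_seqC s t : tens_equiv (mul_seq s t) (mul_seq t s).
Proof.
apply/asboolP; split=> [l lf|S f g e]; last by rewrite !evE mulrC.
rewrite /tens_form /mul_seq !big_allpairs_dep exchange_big; apply: eq_bigr => x _.
by apply: eq_bigr => y _ /=; rewrite (mulrC y.1) (mulrC y.2).
Qed.

Lemma mul_seq_equivl s s' t :
  tens_equiv s s' -> tens_equiv (mul_seq s t) (mul_seq s' t).
Proof.
move=> /asboolP[h1 h2]; apply/asboolP; split=> [l lf|S f g e]; rewrite !evE ?h2 //.
by apply: eq_bigr => y _; rewrite h1 //; exact: linear_formM.
Qed.

Lemma tens_mulE s t : tens_mul (mktens s) (mktens t) = mktens (mul_seq s t).
Proof.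
apply/mktensP; apply: tens_equiv_trans (mul_seq_equivl _ (repr_mktens s)).
rewrite -[X in tens_equiv X]/(mul_seq _ _).
apply: tens_equiv_trans (mul_seqC _ _).
apply: tens_equiv_trans (mul_seq_equivl _ (repr_mktens t)).
exact: mul_seqC.
Qed.

Lemma tens_addA : associative tens_add.
Proof.
move=> x y z; rewrite -(mktensK x) -(mktensK y) -(mktensK z) !tens_addE.
by rewrite catA.
Qed.

Lemma tens_addC : commutative tens_add.
Proof.
move=> x y; rewrite -(mktensK x) -(mktensK y) !tens_addE; apply/mktensP/asboolP.
by split=> *; rewrite !evE addrC.
Qed.

Lemma tens_add0 : left_id (mktens [::]) tens_add.
Proof. by move=> x; rewrite -(mktensK x) tens_addE. Qed.

Lemma tens_addN : left_inverse (mktens [::]) tens_opp tens_add.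
Proof.
move=> x; rewrite -(mktensK x) tens_oppE tens_addE; apply/mktensP/asboolP.
by split=> *; rewrite !evE // addNr /tens_form /tens_eval big_nil.
Qed.

HB.instance Definition _ :=
  GRing.isZmodule.Build tens tens_addA tens_addC tens_add0 tens_addN.

Lemma tens_mulA : associative tens_mul.
Proof.
move=> x y z; rewrite -(mktensK x) -(mktensK y) -(mktensK z) !tens_mulE.
apply/mktensP/asboolP; split=> [l lf|S f g e]; last by rewrite !evE mulrA.
rewrite /tens_form /mul_seq !big_allpairs_dep; apply: eq_bigr => u _ /=.
rewrite !big_allpairs_dep; apply: eq_bigr => v _.
by apply: eq_bigr => w _ /=; rewrite !mulrA.
Qed.

Lemma tens_mulC : commutative tens_mul.
Proof.
move=> x y; rewrite -(mktensK x) -(mktensK y) !tens_mulE.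
by apply/mktensP; exact: mul_seqC.
Qed.

Lemma tens_mul1 : left_id (mktens [:: (1, 1)]) tens_mul.
Proof.
move=> x; rewrite -(mktensK x) tens_mulE; congr mktens.
rewrite /mul_seq /= cats0 -[RHS]map_id; apply: eq_map => -[u v].
by rewrite !mul1r.
Qed.

Lemma tens_mulDl : left_distributive tens_mul tens_add.
Proof.
move=> x y z; rewrite -(mktensK x) -(mktensK y) -(mktensK z).
by rewrite !(tens_addE, tens_mulE) /mul_seq allpairs_cat.
Qed.

HB.instance Definition _ := GRing.Zmodule_isComPzRing.Build tens
  tens_mulA tens_mulC tens_mul1 tens_mulDl.

Definition tens_inl (x : B) : tens := mktens [:: (x, 1)].
Definition tens_inr (y : C) : tens := mktens [:: (1, y)].

Lemma tens_inl_zmod : zmod_morphism tens_inl.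
Proof.
move=> x y; rewrite [RHS](_ : _ = tens_add (tens_inl x) (tens_opp (tens_inl y))) //.
rewrite tens_oppE tens_addE; apply/mktensP/asboolP; split=> [l lf|S f g e].
  by rewrite !evE // /tens_form !big_seq1 /= (proj1 lf) linear_formN // rmorphB mulrBl.
by rewrite !evE /tens_eval !big_seq1 /= rmorphB mulrBl.
Qed.

Lemma tens_inl_monoid : monoid_morphism tens_inl.
Proof.
split=> // x y; rewrite [RHS](_ : _ = tens_mul (tens_inl x) (tens_inl y)) //.
by rewrite tens_mulE /mul_seq /= mulr1.
Qed.

Lemma tens_inr_zmod : zmod_morphism tens_inr.
Proof.
move=> x y; rewrite [RHS](_ : _ = tens_add (tens_inr x) (tens_opp (tens_inr y))) //.
rewrite tens_oppE tens_addE; apply/mktensP/asboolP; split=> [l lf|S f g e].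
  by rewrite !evE // /tens_form !big_seq1 /= mulrBr.
by rewrite !evE /tens_eval !big_seq1 /= rmorphB mulrBr.
Qed.

Lemma tens_inr_monoid : monoid_morphism tens_inr.
Proof.
split=> // x y; rewrite [RHS](_ : _ = tens_mul (tens_inr x) (tens_inr y)) //.
by rewrite tens_mulE /mul_seq /= mulr1.
Qed.

HB.instance Definition _ := GRing.isZmodMorphism.Build B tens tens_inl tens_inl_zmod.
HB.instance Definition _ := GRing.isMonoidMorphism.Build B tens tens_inl tens_inl_monoid.
HB.instance Definition _ := GRing.isZmodMorphism.Build C tens tens_inr tens_inr_zmod.
HB.instance Definition _ := GRing.isMonoidMorphism.Build C tens tens_inr tens_inr_monoid.

Lemma mktens_sum s : mktens s = \sum_(x <- s) tens_inl x.1 * tens_inr x.2.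
Proof.
elim: s => [|[x y] s IH]; first by rewrite big_nil.
rewrite big_cons -IH /=.
rewrite [RHS](_ : _ = tens_add (tens_mul (tens_inl x) (tens_inr y)) (mktens s)) //.
by rewrite tens_mulE tens_addE /mul_seq /= mulr1 mul1r.
Qed.

Section Universal.
Variables (S : comPzRingType) (f : {rmorphism B -> S}) (g : {rmorphism C -> S}).
Hypothesis fg : f \o b =1 g \o c.

Definition tens_lift (x : tens) : S := tens_eval f g (repr x).

Lemma tens_liftE s : tens_lift (mktens s) = tens_eval f g s.
Proof. by have /asboolP[_ h] := repr_mktens s; exact: h. Qed.

Lemma tens_lift_zmod : zmod_morphism tens_lift.
Proof.
move=> x y; rewrite -(mktensK x) -(mktensK y) [X in tens_lift X](_ : _ =
  tens_add (mktens (repr x)) (tens_opp (mktens (repr y)))) //.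
by rewrite tens_oppE tens_addE !tens_liftE !evE.
Qed.

Lemma tens_lift_monoid : monoid_morphism tens_lift.
Proof.
split=> [|x y]; first by rewrite [LHS]tens_liftE /tens_eval big_seq1 !rmorph1 mulr1.
rewrite -(mktensK x) -(mktensK y) [X in tens_lift X](_ : _ =
  tens_mul (mktens (repr x)) (mktens (repr y))) //.
by rewrite tens_mulE !tens_liftE !evE.
Qed.

HB.instance Definition _ := GRing.isZmodMorphism.Build tens S tens_lift tens_lift_zmod.
HB.instance Definition _ := GRing.isMonoidMorphism.Build tens S tens_lift tens_lift_monoid.

Definition tens_liftm : {rmorphism tens -> S} := tens_lift.

End Universal.

(** Lifts are well defined by the second clause of [tens_equiv], and unique because pure tensors
    generate additively. *)
Lemma tens_is_tensor_product : is_tensor_product b c tens_inl tens_inr.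
Proof.
split=> [a|S f g fg].
  apply/mktensP/asboolP; split=> [l [_ lf]|S f g fg].
    by rewrite /tens_form !big_seq1 /= -[b a]mulr1 lf rmorphM mulr1 mulrC.
  by rewrite /tens_eval !big_seq1 !rmorph1 mulr1 mul1r; exact: fg.
exists (tens_liftm fg); split; first split.
- by move=> x; rewrite /= tens_liftE // /tens_eval big_seq1 rmorph1 mulr1.
- by move=> x; rewrite /= tens_liftE // /tens_eval big_seq1 rmorph1 mul1r.
move=> h' [hf hg]; apply: rmorphism_ext => x.
rewrite -(mktensK x) /= tens_liftE // mktens_sum rmorph_sum.
apply: eq_bigr => y _; rewrite rmorphM.
by rewrite -[tens_inl _]/((tens_inl : B -> tens) _) -hf -hg.
Qed.

Lemma tens_form_eq0 s l : linear_form l ->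
  \sum_(x <- s) tens_inl x.1 * tens_inr x.2 = 0 -> tens_form l s = 0.
Proof.
move=> lf; rewrite -mktens_sum => /(mktensP s [::])/asboolP[h _].
by rewrite h // /tens_form big_nil.
Qed.

End TensorProduct.

(** * Mac Lane's criterion *)

(** [T] may be the zero ring, hence the hypothesis [p%:R = 0] in place of a condition on the
    characteristic. *)
Lemma exprD_prime (T : comPzRingType) p (x y : T) : prime p -> p%:R = 0 :> T ->
  (x + y) ^+ p = x ^+ p + y ^+ p.
Proof.
case: p => [//|p] pr p0; rewrite exprDn big_ord_recl big_ord_recr /= big1.
  by rewrite subn0 bin0 subSS subnn binn !mulr1n expr0 mulr1 mul1r add0r.
move=> i _; rewrite /bump /= add1n subSS.
have /dvdnP[q ->] : (p.+1 %| 'C(p.+1, i.+1))%N.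
  by apply: prime_dvd_bin => //; rewrite /= ltnS.
by rewrite -mulr_natr natrM p0 !mulr0.
Qed.

Lemma sumrX_prime (T : comPzRingType) p (I : Type) (s : seq I) (f : I -> T) :
  prime p -> p%:R = 0 :> T -> (\sum_(i <- s) f i) ^+ p = \sum_(i <- s) f i ^+ p.
Proof.
move=> pr p0; elim: s => [|i s IH].
  by rewrite !big_nil expr0n; case: p pr {p0}.
by rewrite !big_cons exprD_prime // IH.
Qed.

(* In the tensor product with K along its Frobenius endomorphism, the
   element sum x_i (x) c_i has p-th power (sum c_i x_i^p) (x) 1. *)
Lemma geometrically_reduced_frobenius (K : fieldType) (E : comPzRingType)
    (j : {rmorphism K -> E}) p (s : seq (E * K)) (l : E -> K) :
  geometrically_reduced j -> p \in [pchar K] -> linear_form j l ->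
  \sum_(x <- s) j x.2 * x.1 ^+ p = 0 ->
  \sum_(x <- s) x.2 * l x.1 ^+ p = 0.
Proof.
move=> gr pK lf s0; have pr := pcharf_prime pK.
pose frob : {rmorphism K -> K} := pFrobenius_aut pK.
have tp := tens_is_tensor_product j frob.
have p0 : p%:R = 0 :> tens j frob.
  rewrite -(rmorph_nat (@tens_inr _ _ _ j frob)) /=.
  by rewrite (eqP (andP pK).2 : p%:R = 0) rmorph0.
(* Reducedness of the tensor product leaves only the p-th power of this element to check. *)
have z0 : \sum_(x <- s) tens_inl j frob x.1 * tens_inr j frob x.2 = 0.
  apply: (gr _ _ _ _ _ tp _ p); rewrite sumrX_prime //.
  rewrite -[RHS](rmorph0 (@tens_inl _ _ _ j frob)) -s0 rmorph_sum.
  apply: eq_bigr => x _; rewrite rmorphM rmorphXn exprMn.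
  (* The right factor is a [K]-algebra through Frobenius, so [x.2 ^+ p] there equals [j x.2] on the
     left. *)
  have /= -> := proj1 tp x.2.
  by rewrite mulrC pFrobenius_autE rmorphXn.
rewrite -[RHS](tens_form_eq0 lf z0); apply: eq_bigr => x _.
by rewrite mulrC.
Qed.

(** A subspace [M] maximal among those containing [H] and avoiding [y] is a hyperplane; [l] is the
    coefficient of [y] modulo [M]. *)
Lemma linear_form_extend (K : fieldType) (E : comPzRingType)
    (j : {rmorphism K -> E}) (H : set E) (y : E) :
  H 0 -> (forall u w, H u -> H w -> H (u + w)) -> (forall a u, H u -> H (j a * u)) ->
  ~ H y ->
  exists l, [/\ linear_form j l, forall u, H u -> l u = 0 & l y = 1].
Proof.
move=> H0 HD HZ Hy.
pose subsp (A : set E) := [/\ H `<=` A, forall u w, A u -> A w -> A (u + w),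
  forall a u, A u -> A (j a * u) & ~ A y].
have [|M [+ Mmax]] := @Zorn_bigcup E (fun A => A = set0 \/ subsp A).
  move=> F FP tot.
  have [[A [FA [A1 A2 A3 A4]]]|nA] := pselect (exists A, F A /\ subsp A); last first.
    left; rewrite -subset0 => x [A FA Ax]; have [A0|sA] := FP A FA.
      by rewrite A0 in Ax.
    by case: nA; exists A.
  right; split.
  - by move=> u Hu; exists A => //; exact: A1.
  - move=> u w [B FB Bu] [C FC Cw].
    have [BC|CB] := tot B C FB FC.
      have [C0|[_ CD _ _]] := FP C FC; first by rewrite C0 in Cw.
      by exists C => //; apply: CD => //; exact: BC.
    have [B0|[_ BD _ _]] := FP B FB; first by rewrite B0 in Bu.
    by exists B => //; apply: BD => //; exact: CB.
  - move=> a u [B FB Bu]; have [B0|[_ _ BZ _]] := FP B FB; first by rewrite B0 in Bu.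
    by exists B => //; exact: BZ.
  - by move=> [B FB By]; have [B0|[]//] := FP B FB; rewrite B0 in By.
move=> [M0|[HM MD MZ My]].
  case: (Mmax H); last by right; split.
  by rewrite M0; split=> [|/(_ 0 H0)].
have decomp x : exists a, M (x - j a * y).
  have [Mx|Mx] := pselect (M x); first by exists 0; rewrite rmorph0 mul0r subr0.
  pose N := [set z | exists a u, M u /\ z = u + j a * x].
  have NM : M `<` N.
    split=> [u Mu|]; first by exists 0, u; rewrite rmorph0 mul0r addr0.
    move=> /(_ x) NMx; apply: Mx; apply: NMx; exists 1, 0.
    by rewrite rmorph1 mul1r add0r; split=> //; exact: HM.
  (* By maximality the span [N] of [M] and [x] contains [y]; solving for [x] gives its
     coefficient. *)
  have [a [u [Mu yE]]] : N y.
    apply: contrapT => Ny; apply: (Mmax N NM); right; split=> //.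
    - by move=> z Hz; apply: (properW NM); exact: HM.
    - move=> _ _ [a [u [Mu ->]]] [b [w [Mw ->]]]; exists (a + b), (u + w).
      by split; [exact: MD | rewrite rmorphD mulrDl addrACA].
    - move=> b _ [a [u [Mu ->]]]; exists (b * a), (j b * u).
      by split; [exact: MZ | rewrite mulrDr rmorphM mulrA].
  have a0 : a != 0.
    by apply/eqP => a0; apply: My; rewrite yE a0 rmorph0 mul0r addr0.
  exists a^-1; rewrite yE mulrDr mulrA -rmorphM mulVf // rmorph1 mul1r.
  rewrite opprD addrCA subrr addr0 -mulN1r -(rmorph1 j) -rmorphN.
  exact/MZ/MZ.
have uniq x a b : M (x - j a * y) -> M (x - j b * y) -> a = b.
  move=> Ma Mb; apply: contrapT => /eqP; rewrite -subr_eq0 => ab; apply: My.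
  rewrite -[y]mul1r -(rmorph1 j) -(mulVf ab) rmorphM -mulrA; apply: (MZ _ _ _).
  have := MD _ _ Mb (MZ (-1) _ Ma); congr M.
  by rewrite rmorphN rmorph1 rmorphB; ring.
pose l x := projT1 (cid (decomp x)).
have lP x : M (x - j (l x) * y) by rewrite /l; case: cid.
exists l; split.
- split=> [u w|a u].
    apply: (uniq _ _ _ (lP _)); have := MD _ _ (lP u) (lP w); congr M.
    by rewrite rmorphD; ring.
  apply: (uniq _ _ _ (lP _)); have := MZ a _ (lP u); congr M.
  by rewrite rmorphM; ring.
- move=> u Hu; apply: (uniq _ _ _ (lP _)).
  by rewrite rmorph0 mul0r subr0; exact: HM.
- apply: (uniq _ _ _ (lP _)); rewrite rmorph1 mul1r subrr; exact: HM.
Qed.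

Lemma msize_mderiv n (R : nzRingType) (i : 'I_n) (F : mpoly n R) :
  F != 0 -> (msize (mderiv i F) < msize F)%N.
Proof.
move=> F0; have [->|dF0] := eqVneq (mderiv i F) 0.
  by rewrite msize0 lt0n msize_poly_eq0.
rewrite -mlead_deg //; have := mlead_supp dF0.
rewrite mcoeff_msupp mcoeff_deriv => c0.
have : mnm_add (mlead (mderiv i F)) (mnm1 i) \in msupp F.
  by rewrite mcoeff_msupp; apply: contraNneq c0 => ->; rewrite mul0rn.
by move=> /msize_mdeg_lt; rewrite mdegD mdeg1 addn1.
Qed.

(* Otherwise F is a polynomial in the X_i ^ p, and Mac Lane's criterion yields a
   relation of smaller degree. *)
Lemma minimal_relation_mderiv (K : fieldType) (E : comNzRingType)
    (j : {rmorphism K -> E}) n (x : 'I_n -> E) (F : mpoly n K) :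
  geometrically_reduced j -> F != 0 -> mmap j x F = 0 ->
  (forall Q : mpoly n K, Q != 0 -> mmap j x Q = 0 -> (msize F <= msize Q)%N) ->
  exists i, mmap j x (mderiv i F) != 0.
Proof.
move=> gr F0 Fx Fmin; apply: contrapT => nex.
have dF i : mderiv i F = 0.
  apply/eqP; apply: contraT => dF0; have := msize_mderiv i F0.
  rewrite ltnNge Fmin //; apply/eqP; apply: contraT => dFx.
  by case: nex; exists i.
have supp0 m i : m \in msupp F -> (m i)%:R = 0 :> K.
  move=> mF; have [->//|mi0] := eqVneq (m i) 0%N.
  have := congr1 (mcoeff (mnm_sub m (mnm1 i))) (dF i).
  rewrite mcoeff_deriv mcoeff0 submK; last first.
    by apply/mnm_lepP => k; rewrite mnm1E; case: eqP => // <-; rewrite lt0n.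
  rewrite mnmBE mnm1E eqxx subn1 prednK ?lt0n // -[mcoeff _ _ *+ _]mulr_natr => /eqP.
  by rewrite mulf_eq0 mcoeff_eq0 mF => /eqP.
have [[m0 [i0 [m0F m0i0]]]|cst] :=
  pselect (exists m i, m \in msupp F /\ m i != 0%N); last first.
  have F1 : (msize F <= 1)%N.
    rewrite -mlead_deg // ltnS leqn0 mdeg_eq0; apply/eqP/mnmP => i.
    rewrite mnm0E; apply/eqP; apply: contraT => mi.
    by case: cst; exists (mlead F), i; split=> //; exact: mlead_supp.
  move: Fx F0; rewrite (msize1_polyC F1) mmapC -(rmorph0 j).
  by move=> /fmorph_inj ->; rewrite mpolyC0 eqxx.
have [p pK] : exists p, p \in [pchar K].
  by apply: (@natf0_pchar _ (m0 i0)); rewrite ?lt0n // supp0.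
have pr := pcharf_prime pK; have p1 := prime_gt1 pr.
(* The vanishing derivatives force all exponents in [F] to be divisible by [p]; [q] divides them by
   [p]. *)
pose q (m : multinom n) : multinom n := Multinom [tuple (m i %/ p)%N | i < n].
have qE m : m \in msupp F -> m = mnm_muln (q m) p.
  move=> mF; apply/mnmP => i; rewrite mulmnE mnmE divnK //.
  by rewrite (dvdn_pcharf pK) supp0.
(* The successor is there because [msize] exceeds the degree by one. If [q m] has degree 0, the
   nonconstant monomial [m0] gives the bound. *)
have q_deg m : m \in msupp F -> ((mdeg (q m)).+1 < msize F)%N.
  move=> mF; have [q0|q0] := posnP (mdeg (q m)).
    rewrite q0; apply: leq_ltn_trans (msize_mdeg_lt m0F).
    rewrite lt0n mdeg_eq0; apply: contraNneq m0i0 => ->; by rewrite mnm0E.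
  apply: leq_ltn_trans (msize_mdeg_lt mF).
  by rewrite [X in (_ < mdeg X)%N]qE // mdegMn ltn_Pmulr.
have xq m : m \in msupp F -> mmap1 x m = mmap1 x (q m) ^+ p.
  move=> mF; rewrite [in LHS](qE m mF) /mmap1 -prodrXl; apply: eq_bigr => i _.
  by rewrite mulmnE exprM.
(* [H] is spanned by the values of the monomials smaller than [F] other than [q m0]. By minimality
   of [F] it misses the value of [q m0], so a linear form separates them. *)
pose H := [set u | exists Q : mpoly n K,
  [/\ (msize Q < msize F)%N, mcoeff (q m0) Q = 0 & u = mmap j x Q]].
have sizeF : (0 < msize F)%N by rewrite lt0n msize_poly_eq0.
have [||||l [lf lH l1]] := @linear_form_extend K E j H (mmap1 x (q m0)).
- by exists 0; rewrite msize0 mcoeff0 mmap0.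
- move=> _ _ [P [P1 P2 ->]] [Q [Q1 Q2 ->]]; exists (P + Q); split.
  + by apply: leq_ltn_trans (msizeD_le _ _) _; rewrite gtn_max P1 Q1.
  + by rewrite mcoeffD P2 Q2 addr0.
  + by rewrite mmapD.
- move=> a _ [P [P1 P2 ->]]; exists (a *: P); split.
  + exact: leq_ltn_trans (msizeZ_le _ _) P1.
  + by rewrite mcoeffZ P2 mulr0.
  + by rewrite mmapZ.
- move=> [Q [Q1 Q2 Qx]]; have : (msize F <= msize (Q - mpolyX K (q m0)))%N.
    apply: Fmin; last by rewrite mmapB mmapX Qx subrr.
    apply/eqP => /(congr1 (mcoeff (q m0))) /eqP.
    by rewrite mcoeffB Q2 mcoeffX eqxx mcoeff0 sub0r oppr_eq0 oner_eq0.
  rewrite leqNgt => /negP; apply; apply: leq_ltn_trans (msizeD_le _ _) _.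
  by rewrite msizeN msizeX gtn_max Q1 q_deg.
(* The relation [F] is a combination of p-th powers of the values of the [q m]. After [l] only the
   term of [m0] survives, which would make its coefficient in [F] zero. *)
have := @geometrically_reduced_frobenius K E j p
  [seq (mmap1 x (q m), mcoeff m F) | m <- msupp F] l gr pK lf.
rewrite !(big_map (fun m => (mmap1 x (q m), mcoeff m F)) predT) /= => h.
have /h : \sum_(m <- msupp F) j (mcoeff m F) * mmap1 x (q m) ^+ p = 0.
  by rewrite -[RHS]Fx /mmap; apply: eq_big_seq => m mF; rewrite (xq m mF).
rewrite (bigD1_seq m0) ?msupp_uniq //= l1 expr1n mulr1 big_seq_cond big1.
  by rewrite addr0 => /eqP; rewrite mcoeff_eq0 m0F.
move=> m /andP[mF mm0]; rewrite lH ?expr0n ?gtn_eqF ?mulr0 // ?prime_gt0 //.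
exists (mpolyX K (q m)); split; rewrite ?msizeX ?q_deg ?mmapX // mcoeffX.
case: eqP => // qm; case/eqP: mm0.
by rewrite (qE m mF) qm -qE.
Qed.

(** * Limits in a valued field *)

Section ValuationLimits.
Variables (G : orderedGroup) (K : fieldType) (v : valuation G K).
Implicit Types (g h : G) (x y : K).

Lemma og_ltD2l g h k : (g + h < g + k :> G) = (h < k).
Proof.
rewrite !lt_neqAle (inj_eq (addrI g)); congr (_ && _).
apply/idP/idP => [l|]; last exact: og_leD2l.
by have := og_leD2l (- g) l; rewrite !addKr.
Qed.

Lemma og_ltNge g h : (g < h :> G) = ~~ (h <= g).
Proof.
apply/idP/idP => [gh|]; first by apply/negP => hg; rewrite (lt_geF gh) in hg.
by have [gh|->//] := orP (og_total g h); rewrite lt_neqAle gh andbT;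
  apply: contraNneq => ->.
Qed.

Lemma val1 : v 1 = 0.
Proof.
have := Defs.valM v (oner_neq0 K) (oner_neq0 K); rewrite mulr1 => /eqP.
by rewrite -subr_eq0 opprD addNKr oppr_eq0 => /eqP.
Qed.

Lemma val_inv x : x != 0 -> v x^-1 = - v x.
Proof.
move=> x0; apply/eqP; rewrite -addr_eq0 -Defs.valM ?invr_eq0 // mulVf //.
by rewrite val1.
Qed.

Lemma vballB g x y : vball v g x -> vball v g y -> vball v g (x - y).
Proof. by move=> gx gy; apply: vballD => //; exact: vballN. Qed.

Lemma vball_neq0 g x : x != 0 -> vball v g x -> g < v x.
Proof. by move=> x0 [/eqP|//]; rewrite (negbTE x0). Qed.

Lemma vball_self x : x != 0 -> ~ vball v (v x) x.
Proof. by move=> x0 /(vball_neq0 x0); rewrite ltxx. Qed.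

Lemma vball_mull x g : exists h, forall y, vball v h y -> vball v g (x * y).
Proof.
have [->|x0] := eqVneq x 0; first by exists 0 => y _; rewrite mul0r; left.
exists (g - v x) => y; have [->|y0] := eqVneq y 0; first by rewrite mulr0; left.
move=> /(vball_neq0 y0) h; right; rewrite Defs.valM //.
by rewrite -(og_ltD2l (v x)) addrC subrK in h.
Qed.

Lemma vballM g h x y : vball v g x -> vball v h y -> vball v (g + h) (x * y).
Proof.
have [->|x0] := eqVneq x 0; first by rewrite mul0r; left.
have [->|y0] := eqVneq y 0; first by rewrite mulr0; left.
move=> /(vball_neq0 x0) gx /(vball_neq0 y0) hy; right; rewrite Defs.valM //.
apply: (@lt_trans _ _ (g + v y)); first by rewrite og_ltD2l.
by rewrite ![_ + v y]addrC og_ltD2l.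
Qed.

Section Limits.
Context (T : Type) (F : set_system T) {FF : Filter F}.
Implicit Types (f e : T -> K) (l m : K).

Definition vlim f l := forall g, F [set t | vball v g (f t - l)].

Lemma vlim_cst l : vlim (fun=> l) l.
Proof. by move=> g; apply: filterE => t; rewrite /= subrr; left. Qed.

Lemma vlim_eq f e l : f =1 e -> vlim e l -> vlim f l.
Proof. by move=> fe el g; apply: filterS (el g) => t /=; rewrite fe. Qed.

Lemma vlimD f e l m : vlim f l -> vlim e m -> vlim (fun t => f t + e t) (l + m).
Proof.
move=> fl em g; apply: filterS (filterI (fl g) (em g)) => t /= [h1 h2].
by rewrite opprD addrACA; exact: vballD.
Qed.

Lemma vlimM f e l m : vlim f l -> vlim e m -> vlim (fun t => f t * e t) (l * m).
Proof.
move=> fl em g; have [h1 h1P] := vball_mull l g; have [h2 h2P] := vball_mull m g.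
(* In the product of the two errors one factor is in the ball of radius [g], the other in that of
   radius [0]; [h1] and [h2] serve the two mixed terms. *)
apply: filterS (filterI (filterI (fl g) (fl h2)) (filterI (em 0) (em h1))).
move=> t /= [[a1 a2] [a3 a4]].
have -> : f t * e t - l * m =
  (f t - l) * (e t - m) + l * (e t - m) + m * (f t - l) by ring.
apply: vballD; last exact: h2P.
by apply: vballD; [rewrite -[g]addr0; exact: vballM | exact: h1P].
Qed.

Lemma vlimX f l n : vlim f l -> vlim (fun t => f t ^+ n) (l ^+ n).
Proof.
move=> fl; elim: n => [|n IH].
  by apply: (@vlim_eq _ (fun=> 1)) => [t|]; rewrite expr0 //; exact: vlim_cst.
by rewrite exprS; apply: vlim_eq (vlimM fl IH) => t; rewrite exprS.
Qed.

Lemma vlim_sum (I : Type) (s : seq I) (f : I -> T -> K) (l : I -> K) :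
  (forall i, vlim (f i) (l i)) ->
  vlim (fun t => \sum_(i <- s) f i t) (\sum_(i <- s) l i).
Proof.
move=> fl; elim: s => [|i s IH].
  by rewrite big_nil; apply: vlim_eq (vlim_cst 0) => t; rewrite big_nil.
by rewrite big_cons; apply: vlim_eq (vlimD (fl i) IH) => t; rewrite big_cons.
Qed.

Lemma vlim_prod (I : Type) (s : seq I) (f : I -> T -> K) (l : I -> K) :
  (forall i, vlim (f i) (l i)) ->
  vlim (fun t => \prod_(i <- s) f i t) (\prod_(i <- s) l i).
Proof.
move=> fl; elim: s => [|i s IH].
  by rewrite big_nil; apply: vlim_eq (vlim_cst 1) => t; rewrite big_nil.
by rewrite big_cons; apply: vlim_eq (vlimM (fl i) IH) => t; rewrite big_cons.
Qed.

(** If [y] were zero or [v y] exceeded [v x], then [y] and [y - x] would both be in the ball of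
    radius [v x], and so would [x]. *)
Lemma vball_val_le x y : x != 0 -> vball v (v x) (y - x) ->
  y != 0 /\ v y <= v x.
Proof.
move=> x0 yx; have nyx : ~ vball v (v x) y.
  move=> y1; apply: (vball_self x0); have := vballB y1 yx.
  by rewrite opprB addrC subrK.
have y0 : y != 0 by apply/eqP => y0; apply: nyx; left.
split=> //; rewrite -[_ <= _]negbK -og_ltNge; apply/negP => h.
by apply: nyx; right.
Qed.

Lemma vlim_neq0 f l : vlim f l -> l != 0 -> F [set t | f t != 0].
Proof.
by move=> fl l0; apply: filterS (fl (v l)) => t /= /(vball_val_le l0)[].
Qed.

Lemma vlimV f l : vlim f l -> l != 0 -> vlim (fun t => (f t)^-1) l^-1.
Proof.
(* The difference of the inverses is, up to sign, [f t - l] divided by [f t * l]. This denominator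
   has value at most [v l + v l], whence the radius. *)
move=> fl l0 g; apply: filterS (filterI (fl (v l)) (fl (g + v l + v l))) => t /=.
move=> [/(vball_val_le l0)[f0 vf] h].
have -> : (f t)^-1 - l^-1 = - ((f t - l) / (f t * l)).
  by field; rewrite l0 f0.
apply: vballN; have [->|fl0] := eqVneq (f t - l) 0; first by rewrite mul0r; left.
right; rewrite Defs.valM ?invr_eq0 ?mulf_neq0 // val_inv ?mulf_neq0 // Defs.valM //.
have {}h := vball_neq0 fl0 h.
rewrite -(og_ltD2l (v (f t) + v l)) addrC [X in _ < X]addrC subrK.
apply: le_lt_trans h; rewrite -addrA; apply: og_leD2l.
by rewrite ![_ + v l]addrC; apply: og_leD2l.
Qed.

End Limits.

End ValuationLimits.

(** * Newton's method over a Henselian valuation ring *)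

(** Taylor expansion at [a]; the factor [f.[a] / w ^+ d.+1] is taken out so that what remains is
    monic in [w]. *)
Lemma newton_value (K : fieldType) (f : {poly K}) (a w : K) d :
  size f = d.+2 -> f^`().[a] != 0 -> w != 0 ->
  f.[a - f.[a] / f^`().[a] / w] = f.[a] / w ^+ d.+1 *
    (w ^+ d.+1 - w ^+ d + \sum_(k < d) (-1) ^+ k *
       (f^`N(k.+2).[a] * f.[a] ^+ k.+1 / f^`().[a] ^+ k.+2) * w ^+ (d.-1 - k)).
Proof.
set b := f.[a]; set s := f^`().[a] => fE s0 w0.
rewrite nderiv_taylor; last exact: mulrC.
rewrite fE !big_ord_recl nderivn0 nderivn1 -/b -/s expr0 expr1 mulr1.
rewrite mulrDr mulrBr addrA; congr (_ + _ + _).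
- by rewrite divfK // expf_neq0.
- by rewrite exprS; field; rewrite w0 s0 expf_neq0.
rewrite mulr_sumr; apply: eq_bigr => k _.
(* Since [k < d], the number [d] is positive and [d.-1 - k] is the true difference of [d.+1] and
   [k.+2]. *)
have -> : w ^+ d.+1 = w ^+ (d.-1 - k) * w ^+ k.+2.
  rewrite -exprD; congr (_ ^+ _); have d0 : (0 < d)%N by case: k; case: (d).
  by rewrite !addnS subnK ?prednK // -ltnS prednK.
rewrite /=; move: (f^`N(k.+2).[a]) (d.-1 - k)%N => c m.
rewrite -[- (b / s / w)]mulN1r !exprMn !exprVn.
have -> : (-1 : K) ^+ k.+2 = (-1) ^+ k by rewrite !exprS mulrA mulrNN !mul1r.
rewrite [b ^+ k.+2]exprS.
have := expf_neq0 m w0; have := expf_neq0 k.+2 w0; have := expf_neq0 k.+2 s0.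
move: (w ^+ m) (w ^+ k.+2) (s ^+ k.+2) (b ^+ k.+1) ((-1) ^+ k).
move=> x1 x2 x3 x4 x5 n1 n2 n3; field.
by rewrite n1 n2 n3.
Qed.

(** The smallness condition is unchanged when [f] or its variable is rescaled, so it suits
    coefficients outside the valuation ring. Its case [k = 0] compares f(a) with the square of
    f'(a). *)
Definition newton_property (G : orderedGroup) (K : fieldType) (v : valuation G K) :=
  forall (f : {poly K}) (a : K), f^`().[a] != 0 ->
  (forall k, vball v 0 (f^`N(k.+2).[a] * f.[a] ^+ k.+1 / f^`().[a] ^+ k.+2)) ->
  exists2 y, f.[y] = 0 &
    forall g, vball v g (f.[a] / f^`().[a]) -> vball v g (y - a).

Section Newton.
Variables (G : orderedGroup) (R : idomainType) (v : valuation G {fraction R}).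
Hypothesis vR : is_valuation_ring v.
Local Notation K := {fraction R}.

Lemma nonunitE (r : R) : (r \isn't a GRing.unit) <-> vball v 0 (tofrac r).
Proof.
have [->|r0] := eqVneq r 0; first by rewrite unitr0 rmorph0; split=> // _; left.
have tr0 : tofrac r != 0 by rewrite tofrac_eq0.
have vr : 0 <= v (tofrac r).
  have [|/eqP|//] := (vR (tofrac r)).1; first by exists r.
  by rewrite (negbTE tr0).
split=> [nr|/(vball_neq0 tr0) h]; last first.
  apply/negP => ru; have : 0 <= v (tofrac r^-1).
    have [|/eqP|//] := (vR (tofrac r^-1)).1; first by exists r^-1.
    by rewrite tofrac_eq0 invr_eq0 (negbTE r0).
  have -> : tofrac r^-1 = (tofrac r)^-1.
    by apply: (mulfI tr0); rewrite -tofracM divrr // tofrac1 divff.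
  rewrite val_inv // => h'.
  by have := og_leD2l (v (tofrac r)) h'; rewrite addr0 subrr => /(lt_le_trans h); rewrite ltxx.
right; rewrite og_ltNge; apply: contra nr => vr'.
have {vr'} vr0 : v (tofrac r) = 0 by apply/eqP; rewrite eq_le vr' vr.
have [|s sE] := (vR (tofrac r)^-1).2; first by right; rewrite val_inv // vr0 oppr0.
apply/unitrP; exists s; rewrite mulrC; suff -> : r * s = 1 by [].
by apply/eqP; rewrite -tofrac_eq tofracM -sE divff // tofrac1.
Qed.

Lemma vball_mul_ring g (x : K) (r : R) :
  vball v g x -> vball v g (x * tofrac r).
Proof.
have [->|x0] := eqVneq x 0; first by rewrite mul0r; left.
have [->|r0] := eqVneq r 0; first by rewrite rmorph0 mulr0; left.
have tr0 : tofrac r != 0 by rewrite tofrac_eq0.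
move=> /(vball_neq0 x0) gx; right; rewrite Defs.valM //.
apply: lt_le_trans gx _; rewrite -{1}[v x]addr0; apply: og_leD2l.
have [|/eqP|//] := (vR (tofrac r)).1; first by exists r.
by rewrite (negbTE tr0).
Qed.

(* With b = f(a) and s = f'(a), the point a - (b / s) / w is a root of f as soon as
   w is a root of W^d - W^(d-1) + sum_(k >= 2) (-1)^k u_k W^(d-k), where
   u_k = f^(k)(a) / k! * b^(k-1) / s^k; modulo the maximal ideal this polynomial is
   W^(d-1) (W - 1). *)
Lemma henselian_newton : henselian R -> newton_property v.
Proof.
move=> hens f a; set b := f.[a]; set s := f^`().[a] => s0 small.
have [b0|b0] := eqVneq b 0; first by exists a => // g _; rewrite subrr; left.
have /choice[u uE] k : exists r : R,
    tofrac r = f^`N(k.+2).[a] * b ^+ k.+1 / s ^+ k.+2.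
  have [|r rE] := (vR (f^`N(k.+2).[a] * b ^+ k.+1 / s ^+ k.+2)).2; last by exists r.
  by case: (small k) => [->|/ltW h]; [left | right].
have u_nonunit k : u k \isn't a GRing.unit by apply/nonunitE; rewrite uE.
have nonunitD (x y : R) : x \isn't a GRing.unit -> y \isn't a GRing.unit ->
    x + y \isn't a GRing.unit.
  by rewrite !nonunitE rmorphD; exact: vballD.
have nonunitM (x y : R) : x \isn't a GRing.unit -> x * y \isn't a GRing.unit.
  by rewrite !nonunitE rmorphM; exact: vball_mul_ring.
have nonunit_sum n (h : 'I_n -> R) : (forall i, h i \isn't a GRing.unit) ->
    \sum_(i < n) h i \isn't a GRing.unit.
  by move=> hi; elim/big_ind: _; rewrite ?unitr0.
case fE : (size f) => [|[|d]].
- have f0 : f = 0 by apply/eqP; rewrite -size_poly_eq0 fE.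
  by move: s0; rewrite /s f0 deriv0 horner0 eqxx.
- by move: s0; rewrite /s (size1_polyC (eq_leq fE)) derivC horner0 eqxx.
pose P : {poly R} := 'X^(d.+1) - 'X^d +
  \sum_(k < d) ((-1) ^+ k * u k) *: 'X^(d.-1 - k).
have Pmonic : P \is monic.
  rewrite /P -addrA monicE lead_coefDl ?lead_coefXn // size_polyXn ltnS.
  apply: leq_trans (size_polyD _ _) _; rewrite geq_max size_polyN size_polyXn leqnn /=.
  apply: leq_trans (size_sum _ _ _) _; apply/bigmax_leqP => k _.
  apply: leq_trans (size_scale_leq _ _) _.
  by rewrite size_polyXn ltnS (leq_trans (leq_subr _ _)) ?leq_pred.
have P1 : P.[1] \isn't a GRing.unit.
  rewrite /P !hornerE !expr1n subrr add0r horner_sum; apply: nonunit_sum => k.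
  by rewrite !hornerE expr1n mulr1 mulrC; exact: nonunitM.
have nonunit1 (x : R) : x \isn't a GRing.unit -> 1 + x \is a GRing.unit.
  move=> xn; apply: contraT => x1n.
  by have := nonunitD _ (- x) x1n; rewrite unitrN addrK unitr1 => /(_ xn).
(* The two leading terms contribute (d + 1) - d = 1 to the derivative at 1; all others contribute
   nonunits. *)
have dP1 : P^`().[1] \is a GRing.unit.
  rewrite /P !derivE raddf_sum !hornerE horner_sum !hornerMn !hornerXn !expr1n.
  rewrite mulrS addrK; apply/nonunit1/nonunit_sum => k /=.
  by rewrite derivZ !hornerE [_ * u k]mulrC -mulrA; exact: nonunitM.
have [w w0 w1] := hens P 1 Pmonic P1 dP1.
have wU : w \is a GRing.unit by rewrite -(subrK 1 w) addrC; exact: nonunit1.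
pose om := tofrac w.
have om0 : om != 0 by rewrite tofrac_eq0; apply: contraTneq wU => ->; rewrite unitr0.
have omV : om^-1 = tofrac w^-1.
  by apply: (mulfI om0); rewrite divff // -tofracM divrr // tofrac1.
exists (a - b / s / om); last first.
  (* The inverse of [w] lies in the ring, so multiplying by it keeps the Newton correction in the
     same balls. *)
  by move=> g gb; rewrite addrAC subrr add0r omV; apply/vballN/vball_mul_ring.
have Pom : om ^+ d.+1 - om ^+ d +
    \sum_(k < d) (-1) ^+ k * (f^`N(k.+2).[a] * b ^+ k.+1 / s ^+ k.+2) * om ^+ (d.-1 - k) = 0.
  rewrite -[RHS]tofrac0 -w0 /P !hornerE horner_sum tofracD tofracB !tofracXn; congr (_ + _).
  rewrite rmorph_sum; apply: eq_bigr => k _ /=.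
  by rewrite hornerZ hornerXn !tofracM !tofracXn tofracN tofrac1 uE.
by rewrite (newton_value fE) // Pom mulr0.
Qed.

End Newton.

(** * Relations as univariate polynomials *)

Lemma rmorph_mmap n (A S T : comNzRingType) (f : {rmorphism A -> S})
    (h : 'I_n -> S) (g : {rmorphism S -> T}) P :
  g (mmap f h P) = mmap (g \o f) (g \o h) P.
Proof.
rewrite /mmap rmorph_sum; apply: eq_bigr => m _; rewrite rmorphM; congr (_ * _).
by rewrite rmorph_prod; apply: eq_bigr => i _; rewrite rmorphXn.
Qed.

Lemma mpoly_rmorph_ext n (A : comNzRingType) (S : comNzRingType)
    (f g : {rmorphism mpoly n A -> S}) :
  (forall c, f (mpolyC n c) = g (mpolyC n c)) ->
  (forall i, f (mpolyX A (mnm1 i)) = g (mpolyX A (mnm1 i))) -> f =1 g.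
Proof.
move=> fgC fgX P; rewrite (mpolyE P) !rmorph_sum; apply: eq_bigr => m _.
rewrite -mul_mpolyC !rmorphM fgC mpolyXE_id !rmorph_prod; congr (_ * _).
by apply: eq_bigr => i _; rewrite !rmorphXn fgX.
Qed.

Section Univariate.
Variables (n : nat) (A : comNzRingType) (i : 'I_n.+1).

Definition univar_coord (k : 'I_n.+1) : {poly mpoly n A} :=
  if unlift i k is Some k' then (mpolyX A (mnm1 k'))%:P else 'X.

(** The standard identification that singles out the variable [i] and puts the other variables into
    the coefficients. *)
Definition univar : {rmorphism mpoly n.+1 A -> {poly mpoly n A}} :=
  mmap (polyC \o @mpolyC n A) univar_coord.

Lemma univarC c : univar (mpolyC _ c) = (mpolyC n c)%:P.
Proof. exact: mmapC. Qed.

Lemma univarX k : univar (mpolyX A (mnm1 k)) = univar_coord k.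
Proof. by rewrite /= mmapX mmap1U. Qed.

Lemma univar_lift k : univar_coord (lift i k) = (mpolyX A (mnm1 k))%:P.
Proof. by rewrite /univar_coord liftK. Qed.

Lemma univar_self : univar_coord i = 'X.
Proof. by rewrite /univar_coord unlift_none. Qed.

Lemma horner_univar (S : comNzRingType) (f : {rmorphism A -> S}) (x : 'I_n.+1 -> S) P :
  (map_poly (mmap f (x \o lift i)) (univar P)).[x i] = mmap f x P.
Proof.
pose ev : {rmorphism mpoly n.+1 A -> S} :=
  (horner_eval (x i) \o map_poly (mmap f (x \o lift i))) \o univar.
rewrite -[LHS]/(ev P); apply: mpoly_rmorph_ext => [c|k].
  by rewrite [LHS]/= univarC map_polyC /= /horner_eval hornerC !mmapC.
rewrite [LHS]/= -/(univar _) univarX /= mmapX mmap1U /horner_eval.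
case: (unliftP i k) => [k'|] ->.
  by rewrite univar_lift map_polyC hornerC /= mmapX mmap1U.
by rewrite univar_self map_polyX hornerX.
Qed.

Lemma deriv_univar P : (univar P)^`() = univar (mderiv i P).
Proof.
(* Only the values on constants and variables matter, so [univar] gives way to an abstract morphism
   [U]; the identity then propagates through products and sums. *)
move: univar univarC univarX => U UC UX.
pose D Q := (U Q)^`() = U (mderiv i Q).
have DM Q Q' : D Q -> D Q' -> D (Q * Q').
  rewrite /D mderivM => h h'.
  by rewrite [U (Q * Q')]rmorphM derivM h h' [RHS]rmorphD !rmorphM.
have DC c : D (mpolyC _ c) by rewrite /D UC mderivC derivC rmorph0.
have DX k : D (mpolyX A (mnm1 k)).
  rewrite /D UX mderivX mnm1E; case: (unliftP i k) => [k'|] ->.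
    by rewrite univar_lift derivC eq_sym (negbTE (neq_lift _ _)) scale0r rmorph0.
  rewrite univar_self derivX eqxx scale1r.
  suff -> : mnm_sub (mnm1 i) (mnm1 i) = @mnm0 n.+1 by rewrite mpolyX0 rmorph1.
  by apply/mnmP => k'; rewrite mnmBE subnn mnm0E.
rewrite -/(D P) (mpolyE P).
elim/big_ind: _ => [|Q Q' h h'|m _].
- by rewrite -mpolyC0; exact: DC.
- by rewrite /D mderivD [U (Q + Q')]rmorphD derivD h h' [RHS]rmorphD.
rewrite -mul_mpolyC; apply: (DM) => //; rewrite mpolyXE_id.
elim/big_ind: _ => [|Q Q'|k _]; [by rewrite -mpolyC1; exact: DC | exact: DM |].
elim: (m k) => [|e IH]; first by rewrite expr0 -mpolyC1; exact: DC.
by rewrite exprS; apply: DM.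
Qed.

End Univariate.

(** * Minimal polynomials without denominators *)

Section MinimalPolynomial.
Variables (A : idomainType) (E : fieldType) (phi : {rmorphism A -> E}) (z : E).
Implicit Types P Q r : {poly A}.

Variable Q0 : {poly A}.
Hypothesis Q0z : (map_poly phi Q0).[z] = 0.
Hypothesis dQ0z : (map_poly phi Q0)^`().[z] != 0.

(* The image of such a Q is, up to a unit, the minimal polynomial of z over the
   fraction field of phi(A); Q itself has no denominators. *)
Lemma univariate_relation_min : exists Q,
  [/\ phi (lead_coef Q) != 0, (map_poly phi Q).[z] = 0 &
      forall r, (size r < size Q)%N -> (map_poly phi r).[z] = 0 -> map_poly phi r = 0].
Proof.
pose good m := `[< exists Q, [/\ size Q = m, map_poly phi Q != 0 & (map_poly phi Q).[z] = 0] >].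
have ex_good : exists m, good m.
  exists (size Q0); apply/asboolP; exists Q0; split=> //.
  by apply: contraNneq dQ0z => ->; rewrite deriv0 horner0.
case: (ex_minnP ex_good) => m /asboolP[Q [Qm Qx0 Qx]] mmin.
have Qmin r : (size r < size Q)%N -> (map_poly phi r).[z] = 0 -> map_poly phi r = 0.
  move=> rQ rx; apply: contrapT => /eqP rx0.
  have : (m <= size r)%N by apply: mmin; apply/asboolP; exists r.
  by rewrite -Qm leqNgt rQ.
exists Q; split=> //; apply: contra Qx0 => /eqP lcQ.
have [->|Q0'] := eqVneq Q 0; first by rewrite rmorph0.
(* If [phi] kills the leading coefficient, dropping the leading term leaves the image unchanged and
   yields a smaller polynomial, whose image is zero by minimality. *)
pose Q1 := Q - lead_coef Q *: 'X^((size Q).-1).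
have evQ1 : map_poly phi Q1 = map_poly phi Q.
  by rewrite /Q1 rmorphB /= map_polyZ /= lcQ scale0r subr0.
rewrite -evQ1; apply/eqP; apply: Qmin; last by rewrite evQ1.
have sQ : (0 < size Q)%N by rewrite lt0n size_poly_eq0.
rewrite -[X in (_ < X)%N](prednK sQ) ltnS; apply/leq_sizeP => k.
rewrite leq_eqVlt coefB coefZ coefXn => /orP[/eqP <-|ltk].
  by rewrite eqxx mulr1 subrr.
rewrite (gtn_eqF ltk) mulr0 subr0 nth_default //.
by rewrite -(prednK sQ).
Qed.

Section Division.
Variable Q : {poly A}.
Hypothesis lcQ : phi (lead_coef Q) != 0.
Hypothesis Qz : (map_poly phi Q).[z] = 0.
Hypothesis Qmin : forall r, (size r < size Q)%N ->
  (map_poly phi r).[z] = 0 -> map_poly phi r = 0.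

(** Pseudo-division stays within [A] at the price of a power of the leading coefficient. The
    remainder is smaller than [Q] and vanishes at [z], so minimality kills its image. *)
Lemma minimal_relation_div P : (map_poly phi P).[z] = 0 ->
  exists m q r, lead_coef Q ^+ m *: P = q * Q + r /\ map_poly phi r = 0.
Proof.
have Q_neq0 : Q != 0.
  by apply: contraNneq lcQ => ->; rewrite lead_coef0 rmorph0.
move=> Pz; exists (scalp P Q), (P %/ Q), (P %% Q).
have PE := Pdiv.Idomain.divp_eq P Q; split=> //.
apply: Qmin; first by rewrite ltn_modp.
have := congr1 (fun p => (map_poly phi p).[z]) PE.
rewrite map_polyZ rmorphD rmorphM /= hornerZ hornerD hornerM Pz Qz !mulr0 add0r.
by move=> <-.
Qed.

(** Simplicity of the root passes from [Q0] to [Q]: otherwise differentiating the pseudo-division of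
    [Q0] would give a zero derivative at [z]. *)
Lemma minimal_relation_deriv : (map_poly phi Q)^`().[z] != 0.
Proof.
have [m [q [r [PE r0]]]] := minimal_relation_div Q0z.
apply: contraNneq dQ0z => dQ.
have := congr1 (fun p => (map_poly phi p)^`().[z]) PE.
rewrite map_polyZ rmorphD rmorphM /= r0 addr0 derivZ hornerZ derivM hornerD !hornerM.
rewrite Qz dQ !mulr0 addr0 => /eqP; rewrite mulf_eq0 rmorphXn expf_eq0.
by rewrite (negbTE lcQ) andbF.
Qed.

(** This extends the specialization [psi] of the coefficients to [z]. In the pseudo-division of [P],
    the coefficients of the remainder are killed by [phi], hence by [psi], and the power of the
    leading coefficient stays nonzero. *)
Lemma minimal_relation_root (F : fieldType) (psi : {rmorphism A -> F}) y P :
  (forall c, phi c = 0 -> psi c = 0) ->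
  psi (lead_coef Q) != 0 -> (map_poly psi Q).[y] = 0 ->
  (map_poly phi P).[z] = 0 -> (map_poly psi P).[y] = 0.
Proof.
move=> sp lcy Qy Pz; have [m [q [r [PE r0]]]] := minimal_relation_div Pz.
have ry : map_poly psi r = 0.
  apply/polyP => k; rewrite coef_map coef0; apply: sp.
  by have := congr1 (fun p : {poly E} => p`_k) r0; rewrite coef_map coef0.
have := congr1 (fun p => (map_poly psi p).[y]) PE.
rewrite map_polyZ rmorphD rmorphM /= ry addr0 hornerZ hornerM Qy mulr0.
move=> /eqP; rewrite mulf_eq0 rmorphXn expf_eq0.
by rewrite (negbTE lcy) andbF => /eqP.
Qed.

End Division.

End MinimalPolynomial.

(** * Approximation in affine space *)

Section Approximation.
Variables (G : orderedGroup) (K E : fieldType).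
Variables (v : valuation G K) (w : valuation G E) (j : {rmorphism K -> E}).
Hypothesis newton : newton_property v.
Hypothesis jv : forall x, x != 0 -> w (j x) = v x.
Hypothesis jdense : forall g (x : E), exists a, vball w g (j a - x).

Lemma vball_fmorph g x : vball w g (j x) <-> vball v g x.
Proof.
have [->|x0] := eqVneq x 0; first by rewrite rmorph0; split=> _; left.
split=> [/vball_neq0 h|/(vball_neq0 x0) h]; right; last by rewrite jv.
by rewrite -jv // h // fmorph_eq0.
Qed.

(* The K-algebra homomorphism K[x] -> K sending x to y exists. *)
Definition specializes n (x : 'I_n -> E) (y : 'I_n -> K) : Prop :=
  forall P : mpoly n K, mmap j x P = 0 -> mmap idfun y P = 0.

Definition approximable n (x : 'I_n -> E) : Prop := forall g, exists y,
  specializes x y /\ forall k, vball w g (j (y k) - x k).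

Section Specializations.
Variables (n : nat) (x : 'I_n -> E) (z : E).

(* The points of K^n x K tending to (x, z), along specializations of x. *)
Definition specialization_filter : set_system (('I_n -> K) * K) :=
  [set A | exists g, forall t, specializes x t.1 ->
    (forall k, vball w g (j (t.1 k) - x k)) -> vball w g (j t.2 - z) -> A t].
Local Notation F := specialization_filter.

Lemma specialization_filter_filter : Filter F.
Proof.
split=> [|A B [g gA] [h hB]|A B AB [g gA]]; first by exists 0.
  have [gh|hg] := orP (og_total g h); [exists h | exists g] => t sp tx tz; split.
  - by apply: gA => // [k|]; apply: vball_le gh _ _.
  - exact: hB.
  - exact: gA.
  - by apply: hB => // [k|]; apply: vball_le hg _ _.
by exists g => t *; apply/AB/gA.
Qed.

#[local] Existing Instance specialization_filter_filter.

(** This serves as properness of the filter: approximability supplies the first coordinates and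
    density the last one. *)
Lemma specialization_filter_ex A : approximable x -> F A ->
  exists2 t, specializes x t.1 & A t.
Proof.
move=> app [g gA]; have [y [sp yx]] := app g; have [a az] := jdense g z.
by exists (y, a) => //; apply: gA.
Qed.

Lemma vlim_spec_coord k : vlim w F (fun t => j (t.1 k)) (x k).
Proof. by move=> g; exists g => t _ /= h _; exact: h. Qed.

Lemma vlim_spec_last : vlim w F (fun t => j t.2) z.
Proof. by move=> g; exists g. Qed.

Lemma vlim_spec_mmap P : vlim w F (fun t => j (mmap idfun t.1 P)) (mmap j x P).
Proof.
apply: (@vlim_eq _ _ w _ F _ _ (fun t => mmap j (j \o t.1) P)).
  by move=> t; exact: (rmorph_mmap idfun).
apply: vlim_sum => m; apply: vlimM; first exact: vlim_cst.
by apply: vlim_prod => k; apply: vlimX; exact: vlim_spec_coord.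
Qed.

Lemma vlim_spec_horner (Q : {poly mpoly n K}) :
  vlim w F (fun t => j (map_poly (mmap idfun t.1) Q).[t.2])
    (map_poly (mmap j x) Q).[z].
Proof.
(* The sum runs over [size Q] for every [t], even when specialization lowers the degree. *)
rewrite /map_poly horner_poly.
apply: (@vlim_eq _ _ w _ F _ _
  (fun t => \sum_(k < size Q) j (mmap idfun t.1 Q`_k) * j t.2 ^+ k)).
  move=> t; rewrite horner_poly rmorph_sum; apply: eq_bigr => k _.
  by rewrite rmorphM rmorphXn.
apply: vlim_sum => k; apply: vlimM; first exact: vlim_spec_mmap.
by apply: vlimX; exact: vlim_spec_last.
Qed.

End Specializations.

(** Along the filter the specialized polynomials [f t] have a value at [t.2] tending to 0 and a
    derivative with nonzero limit, so Newton's method eventually applies. *)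
Lemma approximable_step n (i : 'I_n.+1) (x : 'I_n.+1 -> E) (P : mpoly n.+1 K) :
  mmap j x P = 0 -> mmap j x (mderiv i P) != 0 ->
  approximable (x \o lift i : 'I_n -> E) -> approximable x.
Proof.
set x' : 'I_n -> E := x \o lift i => Px dPx app g.
pose phi : {rmorphism mpoly n K -> E} := mmap j x'.
have P0x : (map_poly phi (univar K i P)).[x i] = 0 by rewrite horner_univar.
have dP0x : (map_poly phi (univar K i P))^`().[x i] != 0.
  by rewrite deriv_map deriv_univar horner_univar.
have [Q [lcQ Qx Qmin]] := univariate_relation_min P0x dP0x.
have dQx := minimal_relation_deriv P0x dP0x lcQ Qx Qmin.
pose F := specialization_filter x' (x i).
have FF : Filter F by exact: specialization_filter_filter.
have lim (S : {poly mpoly n K}) := vlim_spec_horner x' (x i) S.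
pose f (t : ('I_n -> K) * K) : {poly K} := map_poly (mmap idfun t.1) Q.
have limf : vlim w F (fun t => j (f t).[t.2]) 0 by rewrite -Qx; exact: lim.
have limdf : vlim w F (fun t => j (f t)^`().[t.2]) (map_poly phi Q)^`().[x i].
  by rewrite deriv_map; apply: vlim_eq (lim _) => t; rewrite deriv_map.
(* These are the quantities that [newton_property] wants small; each contains a positive power of
   the value of [f t], hence tends to 0. *)
pose u k (t : ('I_n -> K) * K) :=
  (f t)^`N(k.+2).[t.2] * (f t).[t.2] ^+ k.+1 / (f t)^`().[t.2] ^+ k.+2.
have limu k : vlim w F (fun t => j (u k t)) 0.
  pose e (t : ('I_n -> K) * K) := j (f t)^`N(k.+2).[t.2] * j (f t).[t.2] ^+ k.+1 *
    (j (f t)^`().[t.2] ^+ k.+2)^-1.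
  apply: (@vlim_eq _ _ _ _ _ _ _ e) => [t|].
    by rewrite /u /e !rmorphM fmorphV !rmorphXn.
  rewrite -[X in vlim _ _ _ X](mulr0 ((map_poly phi Q)^`N(k.+2).[x i])).
  rewrite -(mul0r ((map_poly phi Q)^`().[x i] ^+ k.+2)^-1) mulrA.
  apply: vlimM; last first.
    by apply: vlimV; [exact: vlimX | rewrite expf_neq0].
  apply: vlimM; last by have := vlimX (FF := FF) k.+1 limf; rewrite expr0n.
  by rewrite nderivn_map; apply: vlim_eq (lim _) => t; rewrite nderivn_map.
have limq : vlim w F (fun t => j ((f t).[t.2] / (f t)^`().[t.2])) 0.
  rewrite -(mul0r ((map_poly phi Q)^`().[x i])^-1).
  apply: vlim_eq (vlimM limf (vlimV limdf dQx)) => t.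
  by rewrite rmorphM fmorphV.
have Flc : F [set t | mmap idfun t.1 (lead_coef Q) != 0].
  apply: filterS (vlim_neq0 (vlim_spec_mmap x' (x i) (lead_coef Q)) lcQ) => t /=.
  by rewrite fmorph_eq0.
have Fdf : F [set t | (f t)^`().[t.2] != 0].
  by apply: filterS (vlim_neq0 limdf dQx) => t /=; rewrite fmorph_eq0.
(* Finitely many [k] suffice, since the higher divided derivatives vanish; a filter is closed under
   finite intersections. *)
have Fu : F [set t | forall k : 'I_(size Q), vball w 0 (j (u k t))].
  apply: (filter_forall (f := fun (k : 'I_(size Q)) t => vball w 0 (j (u k t))) FF).
  by move=> k; apply: filterS (limu k 0) => t /=; rewrite subr0.
have Fx : F [set t | forall k, vball w g (j (t.1 k) - x' k)].
  apply: (filter_forall (f := fun k t => vball w g (j (t.1 k) - x' k)) FF).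
  by move=> k; exact: vlim_spec_coord.
have FI A B : F A -> F B -> F (A `&` B) by exact: filterI.
have FA := FI _ _ (FI _ _ Flc Fdf) (FI _ _ (FI _ _ Fu Fx)
  (FI _ _ (limq g) (@vlim_spec_last _ x' (x i) g))).
have [t sp [[lc df] [[ut tx] [qt tz]]]] := specialization_filter_ex app FA.
have [||y fy ya] := @newton (f t) t.2; [exact: df|move=> k|].
  have [kQ|Qk] := ltnP k (size Q); first by apply/vball_fmorph/(ut (Ordinal kQ)).
  rewrite /f nderivn_map nderivn_poly0 ?rmorph0 ?horner0 ?mul0r; first by left.
  by rewrite (leq_trans Qk) // -addn2 leq_addr.
pose Y k := if unlift i k is Some k' then t.1 k' else y.
have Yi : Y i = y by rewrite /Y unlift_none.
have Yl : (Y \o lift i : 'I_n -> K) = t.1.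
  by apply: funext => k; rewrite /Y /= liftK.
exists Y; split=> [S Sx|k].
  rewrite -(horner_univar i) Yi Yl.
  apply: (minimal_relation_root lcQ Qx Qmin sp lc fy).
  by rewrite horner_univar.
case: (unliftP i k) => [k'|] ->; first by rewrite -[Y _]/((Y \o lift i) k') Yl.
(* The root is as close to [t.2] as the Newton correction is to 0, which [limq] made small, and
   [t.2] is close to [x i]. *)
rewrite Yi -(subrK (j t.2) (j y)) -addrA -rmorphB; apply: vballD => //.
by apply/vball_fmorph/ya/vball_fmorph; rewrite /= subr0 in qt.
Qed.

Theorem geometrically_reduced_approximable n (x : 'I_n -> E) :
  geometrically_reduced j -> approximable x.
Proof.
move=> gr; elim: n x => [|n IH] x.
  move=> g; exists (fun=> 0); split=> [P Px|[]//].
  move: Px; have [c ->] : exists c, P = mpolyC 0 c.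
    by exists (mcoeff mnm0 P); rewrite mpolyKC.
  by rewrite !mmapC /= -(rmorph0 j) => /fmorph_inj.
have [[P [P0 Px]]|indep] := pselect (exists P : mpoly n.+1 K, P != 0 /\ mmap j x P = 0).
  pose rel m := `[< exists P : mpoly n.+1 K, [/\ msize P = m, P != 0 & mmap j x P = 0] >].
  have ex_rel : exists m, rel m by exists (msize P); apply/asboolP; exists P.
  case: (ex_minnP ex_rel) => m /asboolP[Q [Qm Q0 Qx]] mmin.
  have [|i dQ] := minimal_relation_mderiv gr Q0 Qx.
    by move=> S S0 Sx; rewrite Qm; apply: mmin; apply/asboolP; exists S.
  exact: approximable_step Qx dQ (IH _).
move=> g; have /choice[y yx] k := jdense g (x k).
exists y; split=> // P Px; have [->|P0] := eqVneq P 0; first by rewrite mmap0.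
by case: indep; exists P.
Qed.

End Approximation.

(** * Points of a locally ringed space over a local ring *)

Lemma rmorphism_exists (A B : pzRingType) (f : A -> B) :
  zmod_morphism f -> monoid_morphism f -> exists g : {rmorphism A -> B}, g =1 f.
Proof.
move=> fZ fM.
pose fZ' := GRing.isZmodMorphism.Build A B f fZ.
pose fM' := GRing.isMonoidMorphism.Build A B f fM.
pose g : {rmorphism A -> B} := HB.pack f fZ' fM'.
by exists g.
Qed.

Lemma unit_at_pull (X Y : locallyRingedSpace) (f : morphism X Y) (V : opens Y)
    (s : sec V) (x : X) :
  unit_at (@res Y) s (f x) -> unit_at (@res X) (mor_sec f V s) x.
Proof.
move=> [W [WV [Wx [t ts]]]].
have WV' : opens_preim (mor_cont f) W `<=` opens_preim (mor_cont f) V.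
  by move=> y; exact: WV.
exists (opens_preim (mor_cont f) W), WV'; split=> //.
by exists (mor_sec f W t); rewrite -(mor_res WV) -rmorphM ts rmorph1.
Qed.

Lemma spec_cst_zmod (A : comNzRingType) (U : opens (spec A)) :
  zmod_morphism (@spec_cst A U).
Proof.
move=> a b; apply: spec_sec_ext => p Up /=.
rewrite locfracN ?locfracD ?prime_notin1 //.
by apply: locfrac_eqW; rewrite ?prime_notinM ?prime_notin1 //; ring.
Qed.

Lemma spec_cst_monoid (A : comNzRingType) (U : opens (spec A)) :
  monoid_morphism (@spec_cst A U).
Proof.
split=> [|a b]; apply: spec_sec_ext => p Up //=.
by rewrite locfracM ?prime_notin1 ?mulr1.
Qed.

Section LocalRing.
Variables (B : comNzRingType) (m : spec B).
Hypothesis m_units : forall b, b \notin m -> exists b', b' * b = 1.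

Lemma local_notin b q : b \notin m -> b \notin (q : spec B).
Proof.
move=> /m_units[b' bb]; apply/negP => /(prime_inMr b'); rewrite bb.
exact/negP/prime_notin1.
Qed.

(** The closed point [m] is a specialization of every point, so its only open neighbourhood is the
    whole spectrum. *)
Lemma local_open (U : set (spec B)) : open U -> U m -> forall q, U q.
Proof.
move=> /zariski_openE[S ->] [s Ss sm] q; exists s => //; exact: local_notin.
Qed.

Lemma local_locfrac_inj a b : locfrac m a 1 = locfrac m b 1 -> a = b.
Proof.
move=> /(locfrac_eq _ _ (prime_notin1 m) (prime_notin1 m))[u um].
rewrite !mulr1 => uab; have [u' uu] := m_units um.
by apply/eqP; rewrite -subr_eq0 -[_ - _]mul1r -uu -mulrA uab mulr0.
Qed.

(** The fraction given near [m] is valid everywhere by [local_open], and its denominator, being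
    outside [m], is a unit. *)
Lemma local_section (U : opens (spec B)) (s : spec_sec U) : (U : set _) m ->
  exists b, forall q (Uq : (U : set _) q), spec_val s Uq = locfrac q b 1.
Proof.
move=> Um; have [V [oV Vm [a [b sE]]]] := spec_valP s Um.
have [bm _] := sE m Um Vm; have [b' bb] := m_units bm.
exists (a * b') => q Uq; have [bq ->] := sE q Uq (local_open oV Vm q).
by apply: locfrac_eqW; rewrite ?prime_notin1 // -mulrA bb mulr1.
Qed.

Section Factorization.
Variables (X : locallyRingedSpace) (C : comNzRingType).
Variables (i : morphism (Spec C) X) (x : morphism (Spec B) X).
Hypothesis io : open_immersion i.
Hypothesis xm : range i (x m).

Let i_inj : injective i. Proof. by case: io. Qed.
Let i_open U : open U -> open (i @` U). Proof. by case: io => _ + _; exact. Qed.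
Let i_bij (V : opens X) : V `<=` range i -> bijective (mor_sec i V).
Proof. by case: io => _ _; exact. Qed.

Definition image_opens : opens X := Opens (i_open openT).
Local Notation V := image_opens.

Lemma point_in_image q : range i (x q).
Proof. exact: (local_open (mor_cont x (opensP V)) xm). Qed.

(** The graph of the ring map inducing [x]: the function [c] on the chart is carried to its image in
    [X], pulled back along [x] and read in [B]. *)
Definition pulls_to c b := exists2 s : sec V,
  mor_sec i V s = @spec_cst C (opens_preim (mor_cont i) V) c :> spec_sec _ &
  forall q h, @spec_val B (opens_preim (mor_cont x) V) (mor_sec x V s) q h =
    locfrac q b 1.

Lemma pulls_to_ex c : exists b, pulls_to c b.
Proof.
have [g _ gK] := @i_bij V (@subset_refl _ _).
pose s := g (@spec_cst C (opens_preim (mor_cont i) V) c).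
have [b bE] := @local_section (opens_preim (mor_cont x) V) (mor_sec x V s) xm.
by exists b, s => //; exact: gK.
Qed.

Lemma pulls_to_fun c b b' : pulls_to c b -> pulls_to c b' -> b = b'.
Proof.
move=> [s sc sb] [s' sc' sb']; apply: local_locfrac_inj.
have ss : s = s'.
  by apply: (bij_inj (@i_bij V (@subset_refl _ _))); rewrite sc sc'.
by rewrite -(sb m xm) -(sb' m xm) ss.
Qed.

Lemma pulls_to_morphism : exists theta : {rmorphism C -> B},
  forall c, pulls_to c (theta c).
Proof.
have /choice[t tP] := pulls_to_ex.
have tZ : zmod_morphism t.
  move=> c d; apply: pulls_to_fun (tP _) _.
  have [s sc sE] := tP c; have [r rc rE] := tP d; exists (s - r).
    by rewrite rmorphB sc rc; symmetry; exact: spec_cst_zmod.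
  move=> q h; rewrite rmorphB.
  transitivity (locfrac q (t c) 1 - locfrac q (t d) 1).
    by rewrite -(sE q h) -(rE q h).
  rewrite locfracN ?locfracD ?prime_notin1 //.
  by apply: locfrac_eqW; rewrite ?prime_notinM ?prime_notin1 //; ring.
have tM : monoid_morphism t.
  split=> [|c d]; apply: pulls_to_fun (tP _) _.
    exists 1; first by rewrite rmorph1; symmetry; exact: (spec_cst_monoid _).1.
    by move=> q h; rewrite rmorph1.
  have [s sc sE] := tP c; have [r rc rE] := tP d; exists (s * r).
    by rewrite rmorphM sc rc; symmetry; exact: (spec_cst_monoid _).2.
  move=> q h; rewrite rmorphM.
  transitivity (locfrac q (t c) 1 * locfrac q (t d) 1).
    by rewrite -(sE q h) -(rE q h).
  by rewrite locfracM ?prime_notin1 ?mulr1.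
by have [g gE] := rmorphism_exists tZ tM; exists g => c; rewrite gE.
Qed.

Section Equality.
Variables (theta : {rmorphism C -> B}) (thetaP : forall c, pulls_to c (theta c)).

(** An element is outside a prime when its section is a unit there. As [i] and [x] are local, this
    can be tested on [X] at the common image point. *)
Lemma point_comap q : x q = i (comap theta q).
Proof.
have [r _ rE] := point_in_image q; rewrite -rE; congr (i _).
apply: prime_ext => c; rewrite in_comap; apply: negb_inj.
have [s sc sE] := thetaP c; apply/idP/idP.
  move=> cr; have u1 : unit_at (@res (Spec C)) (mor_sec i V s) r.
    rewrite sc; apply/(spec_unit_at (U := opens_preim (mor_cont i) V)
      (Up := (ex_intro2 _ _ r I erefl : (V : set _) (i r))) (prime_notin1 r)) => //.
  have := mor_local (m := i) (ex_intro2 _ _ r I erefl : (V : set _) (i r)) u1.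
  rewrite rE => /unit_at_pull u2.
  apply/(spec_unit_at (prime_notin1 q) (sE q (point_in_image q))); exact: u2.
move=> tq.
have u1 : unit_at (@res (Spec B)) (mor_sec x V s) q.
  exact/(spec_unit_at (prime_notin1 q) (sE q (point_in_image q))).
have := mor_local (m := x) (point_in_image q : (V : set _) (x q)) u1.
rewrite -rE => /unit_at_pull; rewrite sc => u2.
apply/(spec_unit_at (U := opens_preim (mor_cont i) V)
  (Up := (ex_intro2 _ _ r I erefl : (V : set _) (i r))) (prime_notin1 r)); last exact: u2.
by [].
Qed.

(** On the chart the section is locally a / b, so b times it equals a on an open part of [X]. Pulled
    back along [x], this determines it, since theta(b) is invertible at [q]. *)
Lemma point_section (U : opens X) (s : sec U) q
    (h : (opens_preim (mor_cont x) U : set _) q)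
    (h' : (opens_preim (mor_cont i) U : set _) (comap theta q)) :
  @spec_val B (opens_preim (mor_cont x) U) (mor_sec x U s) q h =
  @locmap C B theta q
    (@spec_val C (opens_preim (mor_cont i) U) (mor_sec i U s) (comap theta q) h').
Proof.
have [N [oN Nq [a [b sE]]]] :=
  @spec_valP C (opens_preim (mor_cont i) U) (mor_sec i U s) _ h'.
have [bq ->] := sE _ h' Nq; rewrite locmapE //.
pose W : opens X := Opens (openI (i_open oN) (opensP U)).
have WV : W `<=` V by move=> z [[r _ rz] _]; exists r.
have WU : W `<=` U by move=> z [].
have [sa saE saq] := thetaP a; have [sb sbE sbq] := thetaP b.
have iWV : opens_preim (mor_cont i) W `<=` opens_preim (mor_cont i) V.
  by move=> r; exact: WV.
have iWU : opens_preim (mor_cont i) W `<=` opens_preim (mor_cont i) U.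
  by move=> r; exact: WU.
have xWV : opens_preim (mor_cont x) W `<=` opens_preim (mor_cont x) V.
  by move=> r; exact: WV.
have xWU : opens_preim (mor_cont x) W `<=` opens_preim (mor_cont x) U.
  by move=> r; exact: WU.
have E : res WV sb * res WU s = res WV sa.
  apply: (bij_inj (i_bij (V := W) WV)).
  rewrite rmorphM (mor_res WV iWV) (mor_res WU iWU) (mor_res WV iWV) saE sbE.
  apply: spec_sec_ext => r Wr.
  have Nr : N r by have [[r' Nr' /i_inj <-] _] := Wr.
  have [br rE] := sE r (iWU r Wr) Nr.
  transitivity (locfrac r b 1 * locfrac r a b); first by rewrite -rE.
  rewrite locfracM ?prime_notin1 //.
  by apply: locfrac_eqW; rewrite ?prime_notinM ?prime_notin1 //; ring.
have Wq : (opens_preim (mor_cont x) W : set _) q.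
  by split; rewrite /= ?point_comap //; exists (comap theta q).
have := congr1 (fun t => @spec_val B (opens_preim (mor_cont x) W) t q Wq)
  (congr1 (mor_sec x W) E).
rewrite rmorphM (mor_res WV xWV) (mor_res WU xWU) (mor_res WV xWV) => e.
set y := spec_val _ _.
have {}e : locfrac q (theta b) 1 * y = locfrac q (theta a) 1.
  rewrite -(saq q (xWV q Wq)) -(sbq q (xWV q Wq)) /y.
  by rewrite (Prop_irrelevance h (xWU q Wq)).
have := congr1 (fun t => locfrac q 1 (theta b) * t) e; rewrite mulrA.
rewrite !locfracM ?prime_notin1 //.
by rewrite (@locfrac_eqW _ q _ _ 1 1) ?prime_notinM ?prime_notin1 ?mul1r ?mulr1 //.
Qed.

Lemma point_factor_eq : x = comp_mor i (Spec_map theta).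
Proof.
apply: mor_ext => [q|U s W h h']; first exact: point_comap.
by apply: spec_sec_ext => q Wq; exact: point_section.
Qed.

End Equality.
Lemma local_point_factor : exists theta, x = comp_mor i (Spec_map theta).
Proof.
have [theta thetaP] := pulls_to_morphism.
by exists theta; exact: point_factor_eq.
Qed.

End Factorization.

(** The global function [a], pulled back and read in the localization at [m], gives back its image
    in [B], which embeds there. *)
Lemma Spec_map_inj (A : comNzRingType) (f g : {rmorphism A -> B}) :
  Spec_map f = Spec_map g -> f =1 g.
Proof.
move=> e a; apply: local_locfrac_inj.
pose T : opens (Spec A) := Opens openT.
pose ev (h : morphism (Spec B) (Spec A)) :=
  @spec_val B (opens_preim (mor_cont h) T) (mor_sec h T (@spec_cst A T a)) m I.
have evE h : ev (Spec_map h) = locfrac m (h a) 1.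
  rewrite [LHS](_ : _ = @locmap A B h m (locfrac (comap h m) a 1)) //.
  by rewrite locmapE ?prime_notin1 // rmorph1.
by rewrite -!evE e.
Qed.

End LocalRing.

(** * From affine space to schemes *)

Lemma mmap_eq n (A S : nzRingType) (f g : A -> S) (h k : 'I_n -> S) P :
  f =1 g -> h =1 k -> mmap f h P = mmap g k P.
Proof. by move=> /funext -> /funext ->. Qed.

Lemma mmap_map_mpoly n (A A' S : comNzRingType) (f : {rmorphism A -> A'})
    (g : {rmorphism A' -> S}) (h : 'I_n -> S) P :
  mmap g h (map_mpoly f P) = mmap (g \o f) h P.
Proof.
pose L : {rmorphism mpoly n A -> S} := mmap g h \o map_mpoly f.
rewrite -[LHS]/(L P); apply: mpoly_rmorph_ext => [c|k] /=.
  by rewrite map_mpolyC !mmapC.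
by rewrite map_mpolyX !mmapX.
Qed.

(** Any polynomial representing an element is evaluated at [r]; the kernel hypothesis makes the
    choice irrelevant, whence additivity and multiplicativity. *)
Lemma generates_lift (A C : comNzRingType) (alg : {rmorphism A -> C}) n
    (e : 'I_n -> C) (r : 'I_n -> A) :
  generates alg e -> (forall P, mmap alg e P = 0 -> mmap idfun r P = 0) ->
  exists s : {rmorphism C -> A}, idfun =1 s \o alg /\ forall k, s (e k) = r k.
Proof.
move=> /choice[p pE] ker.
pose s c := mmap idfun r (p c).
have sE c P : c = mmap alg e P -> s c = mmap idfun r P.
  move=> cP; apply/eqP; rewrite -subr_eq0 -mmapB; apply/eqP/ker.
  by rewrite mmapB -cP -[mmap _ _ _]pE subrr.
have sZ : zmod_morphism s.
  by move=> c d; rewrite -mmapB; apply: sE; rewrite mmapB; congr (_ - _); exact: pE.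
have sM : monoid_morphism s.
  split=> [|c d]; first by rewrite (sE _ 1) ?rmorph1.
  by rewrite -[RHS](rmorphM (mmap idfun r)); apply: sE; rewrite rmorphM; congr (_ * _); exact: pE.
have [t tE] := rmorphism_exists sZ sM; exists t; split=> [a|k].
  by rewrite /= tE (sE _ (mpolyC n a)) mmapC.
by rewrite tE (sE _ (mpolyX A (mnm1 k))) mmapX mmap1U.
Qed.

(** Common to both statements: a point of an open set lies in a chart, where it is an algebra map
    and the open set comes from affine space. Only algebra maps then have to be approximated. *)
Lemma base_points_dense (A : comNzRingType) (B : preTopologicalComNzRingType)
    (m : spec B) (X : schemeOver A) (phi : {rmorphism A -> B}) :
  (forall b, b \notin m -> exists b', b' * b = 1) ->
  (forall x : X, exists2 c : chart X, range (ch_imm c) x & finite_type_map (ch_alg c)) ->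
  (forall (C : comNzRingType) (alg : {rmorphism A -> C}) n (e : 'I_n -> C)
      (theta : {rmorphism C -> B}) (O : set 'rV[B]_n),
    generates alg e -> phi =1 theta \o alg -> open O -> O (\row_k theta (e k)) ->
    exists2 s : {rmorphism C -> A}, idfun =1 s \o alg & O (\row_k phi (s (e k)))) ->
  dense (base_points X phi).
Proof.
move=> mB ft approx W [x Wx] oW.
have [c xc [n [e ge]]] := ft (x m).
have [O oO OE] : exists2 O : set 'rV[B]_n, open O &
    forall (theta : {rmorphism ch_ring c -> B}) (x : top_point X phi),
      pt_mor x = comp_mor (ch_imm c) (Spec_map theta) ->
      W x <-> O (\row_i theta (e i)) by exact: oW.
have [theta xE] := local_point_factor mB (ch_open c) xc.
(* [x] is a point over the base, so [theta] is compatible with the algebra structures. *)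
have thE : phi =1 theta \o ch_alg c.
  apply: (Spec_map_inj mB).
  rewrite -(pt_over x) xE -comp_morA ch_over.
  by rewrite -(@Spec_map_comp _ _ _ _ _ (theta \o ch_alg c)).
have [s sE Os] := approx _ _ _ _ theta O ge thE oO ((OE theta x xE).1 Wx).
have yP : comp_mor (so_str X) (comp_mor (ch_imm c) (Spec_map s)) = Spec_map idfun.
  by rewrite -comp_morA ch_over -(Spec_map_comp sE).
pose y : scheme_point X idfun := Point yP.
pose z : top_point X phi :=
  map_point (phi := idfun) (phi' := phi) (rho := phi) (fun=> erefl) y.
exists z; split; last by exists y.
apply/(OE (phi \o s) z); last exact: Os.
by rewrite /= comp_morA -(@Spec_map_comp _ _ _ _ _ (phi \o s)).
Qed.

Lemma og_bound (G : orderedGroup) n (f : 'I_n -> G) : exists g, forall k, f k <= g.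
Proof.
suff [g gP] : exists g, forall k, k \in enum 'I_n -> f k <= g.
  by exists g => k; apply: gP; rewrite mem_enum.
elim: (enum 'I_n) => [|k s [g gP]]; first by exists 0.
have [kg|gk] := orP (og_total (f k) g); [exists g | exists (f k)] => l;
  rewrite in_cons => /orP[/eqP ->//|ls]; first exact: gP.
exact: le_trans (gP l ls) gk.
Qed.

Section ValuedTopology.
Variables (G : orderedGroup) (K : fieldType) (v : valuation G K).
Variables (B : comNzRingType) (i : {rmorphism B -> K}).
Local Notation T := (valued v i).

Lemma valued_nbhs (x : T) (U : set T) : nbhs x U ->
  exists g, forall y : T, vball v g (i y - i x) -> U y.
Proof.
rewrite -nbhs_entourageE => -[E [g gE] EU]; exists g => y xy; apply: EU.
apply/xsectionP; apply: gE => /=.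
by rewrite -opprB; exact: vballN.
Qed.

Lemma valued_ball_open (x : T) g : open ([set y | vball v g (i y - i x)] : set T).
Proof.
rewrite openE => y xy; rewrite /interior -nbhs_entourageE.
exists [set ab | vball v g (i ab.1 - i ab.2)]; first by exists g.
move=> z /xsectionP yz; rewrite /= -(subrK (i y) (i z)) -addrA.
by apply: vballD => //; rewrite -opprB; exact: vballN.
Qed.

Lemma valued_row_open n (O : set 'rV[T]_n) (M : 'rV[T]_n) : open O -> O M ->
  exists g, forall N : 'rV[T]_n,
    (forall k, vball v g (i (N 0 k) - i (M 0 k))) -> O N.
Proof.
move=> oO OM; have [P PM PO] : nbhs M O by apply: open_nbhs_nbhs.
have /choice[f fP] k := valued_nbhs (PM 0 k).
have [g gf] := og_bound f; exists g => N NM; apply: PO => a k.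
by rewrite !ord1; apply: fP; apply: vball_le (gf k) _ (NM k).
Qed.

End ValuedTopology.

Lemma valuation_ring_local (G : orderedGroup) (R : idomainType)
    (v : valuation G {fraction R}) : is_valuation_ring v ->
  exists m : spec R, forall b, b \notin m -> exists b', b' * b = 1.
Proof.
move=> vR; pose p (b : R) := b \isn't a GRing.unit.
have pI : idealr_closed p.
  split; [by rewrite unfold_in /p unitr0 | by rewrite unfold_in /p unitr1 |].
  move=> a u w; rewrite -!topredE /= => /(nonunitE vR) u0 /(nonunitE vR) w0.
  apply/(nonunitE vR); rewrite tofracD tofracM mulrC.
  by apply: vballD => //; exact: vball_mul_ring.
have pP : prime_idealr_closed p.
  by move=> a b; rewrite -!topredE /= /p unitrM negb_and.
exists (Prime pI pP) => b; rewrite -topredE /= /p negbK => bU.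
by exists b^-1; rewrite mulVr.
Qed.

Lemma field_local (K : fieldType) :
  exists m : spec K, forall b, b \notin m -> exists b', b' * b = 1.
Proof.
pose p (b : K) := b == 0.
have pI : idealr_closed p.
  split; [by rewrite unfold_in /p eqxx | by rewrite unfold_in /p oner_eq0 |].
  move=> a u w; rewrite -!topredE /= /p => /eqP -> /eqP ->; by rewrite mulr0 addr0.
have pP : prime_idealr_closed p.
  by move=> a b; rewrite -!topredE /= /p mulf_eq0.
exists (Prime pI pP) => b; rewrite -topredE /= /p => b0.
by exists b^-1; rewrite mulVf.
Qed.

(** * Density and integrality in the completion *)

Section Completion.
Variables (G : orderedGroup) (R : idomainType) (v : valuation G {fraction R}).
Variables (Rh : idomainType) (vh : valuation G {fraction Rh}).
Variables (phi : {rmorphism R -> Rh}) (j : {rmorphism {fraction R} -> {fraction Rh}}).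
Hypotheses (vR : is_valuation_ring v) (vhR : is_valuation_ring vh).
Hypothesis compl : is_completion v vh phi j.

Lemma completion_dense g (x : {fraction Rh}) : exists a, vball vh g (j a - x).
Proof.
have ring_dense g' (y : Rh) : exists a, vball vh g' (j a - tofrac y).
  have [||z [/= hz [a _ az]]] :=
    compl_dense compl (O := [set z | vball vh g' (tofrac z - tofrac y)]).
  - by exists y; rewrite /= subrr; left.
  - exact: (@valued_ball_open _ _ vh Rh (@tofrac Rh) y g').
  by exists (tofrac a); rewrite (compl_frac compl) az.
have [->|x0] := eqVneq x 0; first by exists 0; rewrite rmorph0 subrr; left.
(* Density is known for ring elements. Dividing by an element of the base field with the same value
   as [x], available because [v] is onto [G], brings [x] into the ring. *)
have [c c0 vc] := val_surj v (vh x).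
have jc0 : j c != 0 by rewrite fmorph_eq0.
have [h hP] := vball_mull vh (j c) g.
have [|y yE] := (vhR (x / j c)).2.
  right; rewrite Defs.valM ?invr_eq0 // val_inv // (compl_val compl c0) vc subrr.
  exact: lexx.
have [a ay] := ring_dense h y; exists (c * a).
rewrite rmorphM -[X in _ - X](divfK jc0) yE [X in _ - X]mulrC -mulrBr.
exact: hP.
Qed.

(** [j] preserves values, and membership in each valuation ring is read off the value. *)
Lemma fraction_integral (x : {fraction R}) y :
  j x = tofrac y -> exists a, x = tofrac a.
Proof.
move=> jx; apply/vR; have [->|x0] := eqVneq x 0; [by left | right].
have [|/eqP|] := (vhR (j x)).1; first by exists y.
  by rewrite fmorph_eq0 (negbTE x0).
by rewrite (compl_val compl x0).
Qed.

End Completion.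

Theorem corollary1p2p1 (G : orderedGroup)
    (R : idomainType) (v : valuation G {fraction R})
    (Rh : idomainType) (vh : valuation G {fraction Rh})
    (phi : {rmorphism R -> Rh})
    (j : {rmorphism {fraction R} -> {fraction Rh}}) :
  is_valuation_ring v -> henselian R ->
  is_valuation_ring vh -> is_completion v vh phi j ->
  geometrically_reduced j ->
  (forall X : schemeOver R, of_finite_presentation X ->
    dense (base_points X (phi : {rmorphism R -> valued vh (@tofrac Rh)}))) /\
  (forall V : schemeOver {fraction R}, locally_of_finite_type V ->
    dense (base_points V (j : {rmorphism {fraction R} -> valued vh idfun}))).
Proof.
move=> vR hens vhR compl gr.
have app n (x : 'I_n -> {fraction Rh}) : approximable vh j x.
  apply: geometrically_reduced_approximable gr.
  - exact: henselian_newton hens.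
  - exact: compl_val compl.
  - exact: completion_dense compl.
split=> [X [lfp _ _]|V lft].
  have [m mP] := valuation_ring_local vhR.
  apply: (@base_points_dense R (valued vh (@tofrac Rh)) m) => //.
    move=> x; have [c xc [n [e [ge _]]]] := lfp x.
    by exists c => //; exists n, e.
  move=> C alg n e theta O ge thE oO Oth.
  have [g gO] := valued_row_open oO Oth.
  (* One radius meets two demands: [g] keeps the point in [O], and [0] forces its coordinates into
     [R]. *)
  have [g' gg'] : exists g', forall k : 'I_2, (if k == 0 then g else 0) <= g'.
    exact: og_bound.
  pose x k := tofrac (theta (e k)).
  have [y [sp yx]] := app n x g'.
  (* [j (y k)] differs from an element of [Rh] by one that is zero or of positive value, so it lies
     in [Rh], and hence [y k] in [R]. *)
  have /choice[r rE] k : exists a, y k = tofrac a.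
    have : vball vh 0 (j (y k) - x k) by apply: vball_le (gg' 1) _ (yx k).
    move=> h; have [|b bE] := (vhR (j (y k) - x k)).2.
      by case: h => [->|/ltW h]; [left | right].
    apply: (@fraction_integral _ _ v _ vh phi j vR vhR compl _ (b + theta (e k))).
    by rewrite tofracD -bE subrK.
  have [|s [sA se]] := @generates_lift _ _ alg n e r ge.
    (* A relation over [R] between the generators is one over the fraction field satisfied by [x];
       [sp] carries it to [y], and [tofrac] is injective. *)
    move=> P Pe; apply/eqP; rewrite -tofrac_eq0; apply/eqP.
    transitivity (mmap idfun y (map_mpoly (@tofrac R) P)).
      by rewrite mmap_map_mpoly rmorph_mmap; apply: mmap_eq => // k; rewrite rE.
    apply: sp; rewrite mmap_map_mpoly -(rmorph0 (@tofrac Rh \o theta)) -Pe rmorph_mmap.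
    by apply: mmap_eq => // a; rewrite /= (compl_frac compl) thE.
  exists s => //; apply: gO => k; rewrite !mxE se.
  by have := vball_le (gg' 0) (yx k); rewrite rE (compl_frac compl).
have [m mP] := field_local {fraction Rh}.
apply: (@base_points_dense {fraction R} (valued vh idfun) m) => //.
move=> C alg n e theta O ge thE oO Oth.
have [g gO] := valued_row_open oO Oth.
have [y [sp yx]] := app n (fun k => theta (e k)) g.
have [|s [sA se]] := @generates_lift _ _ alg n e y ge.
  move=> P Pe; apply: sp; rewrite -(rmorph0 theta) -Pe rmorph_mmap.
  by apply: mmap_eq => // a; rewrite thE.
exists s => //; apply: gO => k; rewrite !mxE se; exact: yx.
Qed.
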